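(* Let $\kappa,m,t^*>0$. (1) Suppose that either $m\kappa\le\frac14$; or $m\kappa>\frac14$ and $$t^*\le\frac{\pi m}{\sqrt{4m\kappa-1}}+\frac{2m}{\sqrt{4m\kappa-1}}\sin^{-1}\left(\frac1{\sqrt{4m\kappa}}\right).$$ Let $N\ge1$ be an integer and $\mathcal V\in\mathbb{R}^N$ be arbitrary, and let $\Theta(t)$ and $\Phi(t)$ be two solutions of the inertial Kuramoto system with initial data $(\Theta^0,\dot\Theta^0)$ and $(\Phi^0,\dot\Phi^0)$, respectively. If $\dot\Theta^0=\dot\Phi^0$ and $\Theta(t^* )=\Phi(t^* )$, then $\dot\Theta(t^* )=\dot\Phi(t^* )$. (2) Suppose that $$m\kappa>\frac14,\qquad t^*>\frac{\pi m}{\sqrt{4m\kappa-1}}+\frac{2m}{\sqrt{4m\kappa-1}}\sin^{-1}\left(\frac1{\sqrt{4m\kappa}}\right),\qquad N\ge2.$$ Then there exist a natural frequency vector $\mathcal V\in\mathbb{R}^N$ and initial data $(\Theta^0,\dot\Theta^0)$ and $(\Phi^0,\dot\Phi^0)$ in $\mathbb{R}^N\times\mathbb{R}^N$ such that the solutions $\Theta(t)$ and $\Phi(t)$ of the inertial Kuramoto system with these respective initial data satisfy $$\dot\Theta^0=\dot\Phi^0,\qquad \Theta(t^* )=\Phi(t^* ),\qquad \dot\Theta(t^* )\ne\dot\Phi(t^* ).$$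
   Context: The inertial Kuramoto system with inertia $m$, coupling strength $\kappa$ and natural frequency vector $\mathcal V=(\nu_1,\dots,\nu_N)$ is $$m\ddot\theta_i+\dot\theta_i=\nu_i+\frac{\kappa}{N}\sum_{j=1}^N\sin(\theta_j-\theta_i),\qquad t\ge0,\ i=1,\dots,N,$$ for $\Theta=(\theta_1,\dots,\theta_N):[0,\infty)\to\mathbb{R}^N$ (no reduction modulo $2\pi$); ''initial data $(\Theta^0,\dot\Theta^0)$'' means $\Theta(0)=\Theta^0$ and $\dot\Theta(0)=\dot\Theta^0$. There is a unique global solution for every initial data. *)

(* Defs.v *)
From Stdlib Require Import Reals.
From mathcomp Require Import ssreflect ssrfun ssrbool eqtype ssrnat seq choice
  fintype finfun bigop.

Set Implicit Arguments.
Unset Strict Implicit.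
Unset Printing Implicit Defensive.

Open Scope R_scope.

Notation vec N := {ffun 'I_N -> R}.

Definition nonneg_time (t : R) : Prop := 0 <= t.

(* Curves are functions on all of R, but only their values on [0, +oo) matter:
   [D_in] takes difference quotients inside [nonneg_time], hence a one-sided
   derivative at time 0. *)
Definition is_velocity (N : nat) (X dX : R -> vec N) : Prop :=
  forall (i : 'I_N) (t : R), 0 <= t ->
    D_in (fun s => X s i) (fun s => dX s i) nonneg_time t.

Definition kuramoto_solution (N : nat) (m kappa : R) (nu X0 dX0 : vec N)
    (X dX : R -> vec N) : Prop :=
  X 0 = X0 /\ dX 0 = dX0 /\ is_velocity X dX /\
  exists ddX : R -> vec N,
    is_velocity dX ddX /\
    forall (i : 'I_N) (t : R), 0 <= t ->
      m * ddX t i + dX t i =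
        nu i + kappa / INR N * \big[Rplus/0]_(j < N) sin (X t j - X t i).

Definition critical_time (m kappa : R) : R :=
  PI * m / sqrt (4 * m * kappa - 1)
  + 2 * m / sqrt (4 * m * kappa - 1) * asin (1 / sqrt (4 * m * kappa)).

(* Main.v *)
(* Uniqueness.  Let p be the difference of the two solutions.  By antisymmetry of
   the coupling, p has mean zero.  Since |sin a - sin b| < |a - b| for a <> b,
   whenever p_i is the largest component and is positive,
   m p_i'' + p_i' + kappa p_i > 0.  The critical time is the first zero of the
   solution of m y'' + y' + kappa y = 0, y'(0) = 0; a slight phase shift of y is
   positive on [0, t_star], and the maximum of p_i / y over i and t contradicts the
   strict inequality unless p <= 0, hence p = 0.

   Sharpness.  With zero frequencies, one oscillator facing N - 1 equal ones
   reduces to the damped pendulum m x'' + x' + kappa sin x = 0, and x and -x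
   give the two solutions.  Released at rest from a small angle the pendulum
   reaches 0 before t_star (Sturm comparison), from the angle PI it never does;
   at a limiting angle in between it reaches 0 for the first time exactly at
   t_star, with nonzero velocity. *)

Require Import Defs.
From HB Require Import structures.
From Stdlib Require Import Reals Lra.
From mathcomp Require Import ssreflect ssrfun ssrbool eqtype ssrnat seq choice
  fintype finfun bigop.
From Coquelicot Require Import Coquelicot.

Open Scope R_scope.

(** * Sums and the coupling term *)

(** These instances open the generic lemmas [big_split], [big_distrr] and [exchange_big] to sums of
    reals. *)
HB.instance Definition _ := Monoid.isComLaw.Build R 0 Rplus
  (fun x y z => esym (Rplus_assoc x y z)) Rplus_comm Rplus_0_l.
HB.instance Definition _ := Monoid.isMulLaw.Build R 0 Rmult
  Rmult_0_l Rmult_0_r.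
HB.instance Definition _ := Monoid.isAddLaw.Build R Rmult Rplus
  Rmult_plus_distr_r Rmult_plus_distr_l.

Lemma sum_const (N : nat) (c : R) : \big[Rplus/0]_(j < N) c = INR N * c.
Proof.
elim: N => [|N IH]; first by rewrite big_ord0 /=; ring.
rewrite big_ord_recr IH S_INR /=; ring.
Qed.

Lemma sum_le (N : nat) (P : pred 'I_N) (a b : 'I_N -> R) :
  (forall j, a j <= b j) ->
  \big[Rplus/0]_(j < N | P j) a j <= \big[Rplus/0]_(j < N | P j) b j.
Proof.
move=> H; apply: (big_ind2 (fun x y => x <= y)) => //; first exact: Rle_refl.
by move=> x1 x2 y1 y2 ? ?; exact: Rplus_le_compat.
Qed.

Lemma sum_lt (N : nat) (a b : 'I_N -> R) (i : 'I_N) :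
  (forall j, a j <= b j) -> a i < b i ->
  \big[Rplus/0]_(j < N) a j < \big[Rplus/0]_(j < N) b j.
Proof.
move=> H Hi; rewrite (bigD1 i) //= [X in _ < X](bigD1 i) //=.
exact: Rplus_lt_le_compat Hi (sum_le _ _ _ _ H).
Qed.

Lemma sum_sub (N : nat) (a b : 'I_N -> R) :
  \big[Rplus/0]_(j < N) (a j - b j) =
  \big[Rplus/0]_(j < N) a j - \big[Rplus/0]_(j < N) b j.
Proof.
have -> : \big[Rplus/0]_(j < N) (a j - b j) =
          \big[Rplus/0]_(j < N) (a j + (-1) * b j).
  by apply: eq_bigr => j _; ring.
rewrite big_split -big_distrr /=; ring.
Qed.

(** Exchanging the two indices and using that sine is odd, the double sum equals its own
    opposite. *)
Lemma sum_coupling (N : nat) (a : 'I_N -> R) :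
  \big[Rplus/0]_(i < N) \big[Rplus/0]_(j < N) sin (a j - a i) = 0.
Proof.
have H : \big[Rplus/0]_(i < N) \big[Rplus/0]_(j < N) sin (a j - a i) =
  -1 * \big[Rplus/0]_(i < N) \big[Rplus/0]_(j < N) sin (a j - a i).
  rewrite {1}exchange_big /= big_distrr; apply: eq_bigr => i _.
  rewrite /= big_distrr; apply: eq_bigr => j _ /=.
  have -> : a i - a j = - (a j - a i) by ring.
  rewrite sin_neg; ring.
lra.
Qed.

Lemma sin_sub_gt (a b : R) : a < b -> a - b < sin a - sin b.
Proof.
move=> Hab.
have -> : sin a - sin b = - (2 * cos ((a + b) / 2) * sin ((b - a) / 2)).
  rewrite form4.
  have -> : (a - b) / 2 = - ((b - a) / 2) by field.
  rewrite sin_neg; ring.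
have Hh : 0 < (b - a) / 2 by lra.
(* For the lower bound, the sine is positive up to 1, and beyond 1 the bound -1 is enough; the value
   1 is treated apart to keep the inequality strict. *)
have [H1 H2] : - ((b - a) / 2) < sin ((b - a) / 2) < (b - a) / 2.
  split; last exact: sin_lt_x.
  have [H|H] := Rlt_le_dec ((b - a) / 2) 1.
    have : 0 < sin ((b - a) / 2) by apply: sin_gt_0 => //; have := PI2_1; lra.
    lra.
  have [] := Req_dec ((b - a) / 2) 1 => [->|?].
    have : 0 < sin 1 by apply: sin_gt_0; have := PI2_1; lra.
    lra.
  have [? ?] := SIN_bound ((b - a) / 2); lra.
have := COS_bound ((a + b) / 2).
move: (cos _) (sin _) H1 H2 => c s H1 H2 [Hc1 Hc2].
case: (Rle_dec 0 s) => Hs; nra.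
Qed.

(* The mean of [a - b] vanishes, so summing [a j - b j - (a i - b i)] over [j]
   leaves only [- N (a i - b i)]. *)
Lemma coupling_gt (N : nat) (a b : 'I_N -> R) (i : 'I_N) :
  (forall j, a j - b j <= a i - b i) ->
  \big[Rplus/0]_(j < N) (a j - b j) = 0 -> 0 < a i - b i ->
  - (INR N * (a i - b i)) <
  \big[Rplus/0]_(j < N) sin (a j - a i) - \big[Rplus/0]_(j < N) sin (b j - b i).
Proof.
move=> Hmax Hsum Hpos.
rewrite -sum_sub.
have -> : - (INR N * (a i - b i)) =
    \big[Rplus/0]_(j < N) ((a j - b j) - (a i - b i)).
  rewrite sum_sub Hsum sum_const; ring.
have Hle j : a j - b j - (a i - b i) <= sin (a j - a i) - sin (b j - b i).
  have [H|H] := Rle_lt_or_eq_dec _ _ (Hmax j).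
    have := sin_sub_gt (a j - a i) (b j - b i); lra.
  have -> : a j - a i = b j - b i by lra.
  lra.
(* One strict term makes the sum strict. If there is none, all differences equal the positive
   [a i - b i], against the zero sum. *)
case: (Classical_Prop.classic (exists j, a j - b j < a i - b i)) => [[j Hj]|Hno].
  apply: (sum_lt _ _ _ j) => //.
  have := sin_sub_gt (a j - a i) (b j - b i); lra.
exfalso.
have E : \big[Rplus/0]_(j < N) (a j - b j) = INR N * (a i - b i).
  rewrite -sum_const; apply: eq_bigr => j _.
  have := Hmax j; case: (Rlt_le_dec (a j - b j) (a i - b i)) => // H; last lra.
  by case: Hno; exists j.
have HN : 0 < INR N by apply: lt_0_INR; apply/ssrnat.ltP; case: (N) i {Hmax Hsum Hpos Hle Hno E} => [[]|].
nra.
Qed.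

Lemma ex_argmax (N : nat) (c : 'I_N -> R) :
  (0 < N)%N -> exists i, forall j, c j <= c i.
Proof.
case: N c => // N c _.
have [i Hi] : exists i, forall j, j \in enum 'I_N.+1 -> c j <= c i.
  elim: (enum _) => [|k s [i Hi]]; first by exists ord0.
  case: (Rle_dec (c k) (c i)) => H.
    exists i => j; rewrite in_cons => /orP [/eqP -> //|]; exact: Hi.
  exists k => j; rewrite in_cons => /orP [/eqP -> |/Hi]; lra.
by exists i => j; apply: Hi; rewrite mem_enum.
Qed.

(** * Calculus on the line *)

(** The second derivative [l > 0] makes [df] positive just after [a], and the mean value theorem
    concludes. The bound [b] keeps the point inside a prescribed interval. *)
Lemma increase_after (f df : R -> R) (a b l : R) :
  a < b -> (forall x, is_derive f x (df x)) -> df a = 0 ->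
  is_derive df a l -> 0 < l -> exists t, a < t < b /\ f a < f t.
Proof.
move=> Hab Hf H0 /is_derive_Reals Hl Hpos.
have [d Hd] := Hl (l / 2) ltac:(lra).
have Hinc x : a < x < a + d -> 0 < df x.
  move=> Hx; have := Hd (x - a) ltac:(lra) ltac:(rewrite Rabs_pos_eq; lra).
  rewrite H0 Rminus_0_r; have -> : a + (x - a) = x by ring.
  move=> /Rabs_def2 [_ H]; have : 0 < df x / (x - a) by lra.
  move=> Hq; have -> : df x = df x / (x - a) * (x - a) by field; lra.
  apply: Rmult_lt_0_compat; lra.
have Hdp := cond_pos d.
set t := Rmin (a + d / 2) ((a + b) / 2).
have [Ht1 Ht2] : t <= a + d / 2 /\ t <= (a + b) / 2.
  by split; [exact: Rmin_l | exact: Rmin_r].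
have Ht : a < t by apply: Rmin_glb_lt; lra.
exists t; split; first lra.
have [c [Hc1 Hc2]] := MVT_cor2 f df a t Ht (fun c _ => proj1 (is_derive_Reals f c (df c)) (Hf c)).
have : 0 < df c by apply: Hinc; lra.
nra.
Qed.

Lemma interior_max_derive (f : R -> R) (a b c l : R) :
  a < c < b -> is_derive f c l -> (forall x, a <= x <= b -> f x <= f c) -> l = 0.
Proof.
move=> Hc /is_derive_Reals Hl Hmax.
have pr : derivable_pt f c by exists l.
have <- := derive_pt_eq_0 _ _ _ pr Hl.
apply: (deriv_maximum f a b c pr) => *; try apply: Hmax; lra.
Qed.

Lemma derive_zero_const (f df : R -> R) (b : R) :
  (forall x, is_derive f x (df x)) -> (forall x, 0 <= x <= b -> df x = 0) ->
  forall x, 0 <= x <= b -> f x = f 0.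
Proof.
move=> Hf H0 x Hx.
case: (Req_dec x 0) => [->//|Hn].
have [c [Hc1 Hc2]] := MVT_cor2 f df 0 x ltac:(lra)
  (fun c _ => proj1 (is_derive_Reals f c (df c)) (Hf c)).
rewrite H0 in Hc1; lra.
Qed.

Lemma is_derive_continuity_pt (f : R -> R) (x l : R) :
  is_derive f x l -> continuity_pt f x.
Proof.
move=> /is_derive_Reals H; apply: derivable_continuous_pt; by exists l.
Qed.

Definition glue (f g : R -> R) (t : R) : R := if Rle_dec 0 t then f t else g t.

Lemma glue_pos (f g : R -> R) (t : R) : 0 <= t -> glue f g t = f t.
Proof. by rewrite /glue; case: Rle_dec. Qed.

Lemma glue_neg (f g : R -> R) (t : R) : t < 0 -> glue f g t = g t.
Proof. by rewrite /glue; case: Rle_dec => // ? ?; exfalso; lra. Qed.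

(** At 0 the right quotients come from [f] and the left ones from [g], with a common limit.
    Elsewhere a radius below the distance to 0 leaves a single branch in view. *)
Lemma glue_derive (f df g dg : R -> R) :
  (forall t, 0 <= t -> D_in f df nonneg_time t) ->
  (forall t, t <= 0 -> is_derive g t (dg t)) ->
  f 0 = g 0 -> df 0 = dg 0 ->
  forall t, is_derive (glue f g) t (glue df dg t).
Proof.
move=> Hf Hg E dE t; apply/is_derive_Reals => eps Heps.
have Rt : 0 <= t -> exists d : R, 0 < d /\ forall h, h <> 0 -> Rabs h < d ->
    0 <= t + h -> Rabs ((f (t + h) - f t) / h - df t) < eps.
  move=> Ht; have [d [Hd H]] := Hf t Ht eps Heps.
  exists d; split => // h Hh Hhd Hth.
  have := H (t + h); rewrite /= /R_dist /D_x /nonneg_time.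
  have -> : t + h - t = h by ring.
  apply; repeat split => //; lra.
have Lt : t <= 0 -> exists d : R, 0 < d /\ forall h, h <> 0 -> Rabs h < d ->
    Rabs ((g (t + h) - g t) / h - dg t) < eps.
  move=> Ht; have /is_derive_Reals H := Hg t Ht.
  have [d Hd] := H eps Heps.
  by exists d; split => //; exact: cond_pos.
case: (Rtotal_order t 0) => [Hlt|[H0|Hgt]].
- have [d [Hd H]] := Lt ltac:(lra).
  have Hd' : 0 < Rmin d (- t) by apply: Rmin_glb_lt; lra.
  exists (mkposreal _ Hd') => h Hh /= Hhd.
  have := Rmin_l d (- t); have := Rmin_r d (- t) => ? ?.
  have [_ Hh2] := Rabs_def2 h (- t) ltac:(lra).
  have [Hh1 _] := Rabs_def2 h (- t) ltac:(lra).
  rewrite !glue_neg; try lra; apply: H => //; lra.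
- subst t; have [d1 [Hd1 H1]] := Rt (Rle_refl 0).
  have [d2 [Hd2 H2]] := Lt (Rle_refl 0).
  have Hd' : 0 < Rmin d1 d2 by apply: Rmin_glb_lt.
  exists (mkposreal _ Hd') => h Hh /= Hhd.
  have := Rmin_l d1 d2; have := Rmin_r d1 d2 => ? ?.
  rewrite !(glue_pos _ _ 0); try lra.
  case: (Rle_dec 0 (0 + h)) => Hc.
    rewrite glue_pos //; apply: H1 => //; lra.
  rewrite glue_neg; last lra.
  rewrite E dE; apply: H2 => //; lra.
- have [d [Hd H]] := Rt ltac:(lra).
  have Hd' : 0 < Rmin d t by apply: Rmin_glb_lt; lra.
  exists (mkposreal _ Hd') => h Hh /= Hhd.
  have := Rmin_l d t; have := Rmin_r d t => ? ?.
  have [Hh1 Hh2] := Rabs_def2 h t ltac:(lra).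
  rewrite !glue_pos; try lra; apply: H => //; lra.
Qed.

(* Continuing by the second-order Taylor polynomial at 0 turns one-sided
   derivatives into two-sided ones. *)
Lemma extend_C2 (f df ddf : R -> R) :
  (forall t, 0 <= t -> D_in f df nonneg_time t) ->
  (forall t, 0 <= t -> D_in df ddf nonneg_time t) ->
  exists F dF ddF : R -> R,
    (forall t, is_derive F t (dF t)) /\ (forall t, is_derive dF t (ddF t)) /\
    (forall t, 0 <= t -> F t = f t /\ dF t = df t /\ ddF t = ddf t).
Proof.
move=> H1 H2.
exists (glue f (fun t => f 0 + df 0 * t + ddf 0 * t ^ 2 / 2)).
exists (glue df (fun t => df 0 + ddf 0 * t)).
exists (glue ddf (fun=> ddf 0)).
split; [|split].
- apply: glue_derive => //; try field.
  move=> t _; auto_derive => //; field.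
- apply: glue_derive => //; try field.
  move=> t _; auto_derive => //; field.
- by move=> t Ht; rewrite !glue_pos.
Qed.

(** * Comparison with a linear oscillator *)

(** Maximizes [p i / y] in time for each index, then over the indices. The conclusion is
    cross-multiplied to spare its users the quotients. *)
Lemma barrier_max (N : nat) (p : 'I_N -> R -> R) (y : R -> R) (T : R) :
  (0 < N)%N -> 0 <= T ->
  (forall i t, 0 <= t <= T -> continuity_pt (p i) t) ->
  (forall t, 0 <= t <= T -> continuity_pt y t) ->
  (forall t, 0 <= t <= T -> 0 < y t) ->
  exists i t0, 0 <= t0 <= T /\
    forall j s, 0 <= s <= T -> p j s * y t0 <= p i t0 * y s.
Proof.
move=> HN HT Hp Hy Hpos.
have Hmax i : exists ti, 0 <= ti <= T /\
    forall s, 0 <= s <= T -> p i s / y s <= p i ti / y ti.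
  have [|ti [H1 H2]] := continuity_ab_maj (fun t => p i t / y t) 0 T HT.
    move=> c Hc; apply: continuity_pt_div; [exact: Hp|exact: Hy|].
    have := Hpos c Hc; lra.
  by exists ti.
have [tm Htm] := fin_all_exists Hmax.
have [i Hi] := ex_argmax N (fun i => p i (tm i) / y (tm i)) HN.
exists i, (tm i); split; first by case: (Htm i).
move=> j s Hs.
have H : p j s / y s <= p i (tm i) / y (tm i).
  by apply: Rle_trans (Hi j); case: (Htm j) => _; apply.
have Hys := Hpos s Hs; have Hyt := Hpos _ (proj1 (Htm i)).
have E1 : p j s * y (tm i) = p j s / y s * (y s * y (tm i)) by field; lra.
have E2 : p i (tm i) * y s = p i (tm i) / y (tm i) * (y s * y (tm i)) by field; lra.
rewrite E1 E2; apply: Rmult_le_compat_r => //; apply: Rmult_le_pos; lra.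
Qed.

(* With [c] the maximum of [p i / y] over indices and times, [p i - c y <= 0]
   touches 0 at the maximum point, where it would be strictly convex. *)
Lemma barrier (N : nat) (p dp ddp : 'I_N -> R -> R) (y dy ddy : R -> R)
    (m kappa T : R) :
  0 < m -> 0 <= T ->
  (forall i t, is_derive (p i) t (dp i t)) ->
  (forall i t, is_derive (dp i) t (ddp i t)) ->
  (forall t, is_derive y t (dy t)) ->
  (forall t, is_derive dy t (ddy t)) ->
  (forall t, 0 <= t <= T -> 0 < y t) ->
  (forall t, 0 <= t <= T -> m * ddy t + dy t + kappa * y t <= 0) ->
  (forall i t, 0 <= t <= T -> (forall j, p j t <= p i t) -> 0 < p i t ->
     0 < m * ddp i t + dp i t + kappa * p i t) ->
  (forall i, p i T <= 0) ->
  forall i d, 0 <= d <= T -> 0 < p i d ->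
  (forall j, p j 0 * y d < p i d * y 0) -> False.
Proof.
move=> Hm HT Hp Hdp Hy Hdy Hpos Hsup Hsub HpT i d Hd Hpd H0.
have HN : (0 < N)%N by case: (N) i {Hpd H0} => [[]|].
have [k [t0 [Ht0 Hmax]]] := barrier_max N p y T HN HT
  (fun i t _ => is_derive_continuity_pt _ _ _ (Hp i t))
  (fun t _ => is_derive_continuity_pt _ _ _ (Hy t)) Hpos.
have Hy0 := Hpos t0 Ht0; have Hyd := Hpos d Hd.
have Hk : 0 < p k t0.
  have := Hmax i d Hd => H.
  have : 0 < p i d * y t0 by apply: Rmult_lt_0_compat.
  nra.
(* The maximum is interior: [p k] is nonpositive at [T], and by [H0] every quotient at time 0 is
   below the one of [p i] at [d]. *)
have HtT : t0 <> T by move=> E; have := HpT k; rewrite -E; lra.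
have Ht00 : t0 <> 0.
  move=> E; have := Hmax i d Hd; have := H0 k; rewrite -E; lra.
set c := p k t0 / y t0.
have Hc : 0 < c by apply: Rdiv_lt_0_compat.
have Ec : c * y t0 = p k t0 by rewrite /c; field; lra.
have Hle s : 0 <= s <= T -> p k s - c * y s <= p k t0 - c * y t0.
  move=> Hs; have := Hmax k s Hs; rewrite Ec -Ec => H.
  have : p k s <= c * y s by nra.
  lra.
have Df t : is_derive (fun t => p k t - c * y t) t (dp k t - c * dy t).
  by apply: (is_derive_minus (V := R_NormedModule)) => //; apply: is_derive_scal.
have Ddf t : is_derive (fun t => dp k t - c * dy t) t (ddp k t - c * ddy t).
  by apply: (is_derive_minus (V := R_NormedModule)) => //; apply: is_derive_scal.
have Z : dp k t0 - c * dy t0 = 0.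
  by apply: (interior_max_derive (fun t => p k t - c * y t) 0 T t0) => //; lra.
have Hconv : 0 < ddp k t0 - c * ddy t0.
  have H1 : 0 < m * ddp k t0 + dp k t0 + kappa * p k t0.
    (* At the fixed time [t0] the index with the largest quotient also has the largest component. *)
    apply: Hsub => // j; have := Hmax j t0 Ht0 => H; nra.
  have H2 := Hsup t0 Ht0.
  have H3 : 0 < m * (ddp k t0 - c * ddy t0).
    have -> : m * (ddp k t0 - c * ddy t0) =
      (m * ddp k t0 + dp k t0 + kappa * p k t0)
      - c * (m * ddy t0 + dy t0 + kappa * y t0) by rewrite -Ec; lra.
    nra.
  nra.
have [t [Ht1 Ht2]] := increase_after (fun t => p k t - c * y t) _ t0 T _
  ltac:(lra) Df Z (Ddf t0) Hconv.
have := Hle t ltac:(lra); lra.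
Qed.

(** * Damped linear oscillations *)

Definition phase_wave (m w phi t : R) : R := exp (- t / (2 * m)) * cos (w * t - phi).

Definition phase_wave' (m w phi t : R) : R :=
  exp (- t / (2 * m)) * (- cos (w * t - phi) / (2 * m) - w * sin (w * t - phi)).

Definition phase_wave'' (m w phi t : R) : R :=
  exp (- t / (2 * m)) *
  (cos (w * t - phi) / (4 * m ^ 2) + w * sin (w * t - phi) / m
   - w ^ 2 * cos (w * t - phi)).

Lemma phase_wave_derive (m w phi t : R) : 0 < m ->
  is_derive (phase_wave m w phi) t (phase_wave' m w phi t).
Proof.
move=> Hm; rewrite /phase_wave /phase_wave'; auto_derive; first by [].
by rewrite /Rdiv /Rminus; field; lra.
Qed.

Lemma phase_wave'_derive (m w phi t : R) : 0 < m ->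
  is_derive (phase_wave' m w phi) t (phase_wave'' m w phi t).
Proof.
move=> Hm; rewrite /phase_wave' /phase_wave''; auto_derive; first by [].
by rewrite /Rdiv /Rminus; field; lra.
Qed.

(** The frequency is a free parameter: varying [w] tunes the stiffness [m w^2 + 1 / (4 m)] to lie
    above, at or below [kappa]. *)
Lemma phase_wave_ode (m w phi t : R) : 0 < m ->
  m * phase_wave'' m w phi t + phase_wave' m w phi t =
  - (m * w ^ 2 + / (4 * m)) * phase_wave m w phi t.
Proof.
by move=> Hm; rewrite /phase_wave'' /phase_wave' /phase_wave; field; lra.
Qed.

(** The phase of the wave released at rest at time 0. Its first zero is at
    [(PI / 2 + rest_phase m w) / w]. *)
Definition rest_phase (m w : R) : R := atan (/ (2 * m * w)).

Lemma rest_phase_bound (m w : R) : 0 < m -> 0 < w -> 0 < rest_phase m w < PI / 2.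
Proof.
move=> Hm Hw; split; last by case: (atan_bound (/ (2 * m * w))).
rewrite -atan_0; apply: atan_increasing; apply: Rinv_0_lt_compat; nra.
Qed.

Lemma phase_wave'_rest (m w : R) : 0 < m -> 0 < w ->
  phase_wave' m w (rest_phase m w) 0 = 0.
Proof.
move=> Hm Hw; rewrite /phase_wave'.
have Hb := rest_phase_bound m w Hm Hw.
have Hc : 0 < cos (rest_phase m w) by apply: cos_gt_0; lra.
have Ht : sin (rest_phase m w) = / (2 * m * w) * cos (rest_phase m w).
  have <- : tan (rest_phase m w) = / (2 * m * w) by exact: tan_atan.
  rewrite /tan; field; lra.
rewrite Rmult_0_r Rminus_0_l cos_neg sin_neg Ht; field; lra.
Qed.

Lemma pos_right_near (h : R -> R) (b : R) :
  continuity_pt h 0 -> 0 < h 0 -> 0 < b -> exists e, 0 < e < b /\ 0 < h e.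
Proof.
move=> Hc H0 Hb; have [d [Hd H]] := Hc (h 0) H0.
set e := Rmin (d / 2) (b / 2).
have H1 : e <= d / 2 by exact: Rmin_l.
have H2 : e <= b / 2 by exact: Rmin_r.
have He : 0 < e by apply: Rmin_glb_lt; lra.
exists e; split; first lra.
have := H e; rewrite /= /R_dist /D_x /no_cond Rminus_0_r.
move=> /(_ _) Hx; have /Rabs_def2 : Rabs (h e - h 0) < h 0.
  by apply: Hx; split; [split => //; lra | rewrite Rabs_pos_eq; lra].
lra.
Qed.

Lemma phase_wave_pos (m w phi t : R) :
  - (PI / 2) < w * t - phi < PI / 2 -> 0 < phase_wave m w phi t.
Proof.
move=> H; apply: Rmult_lt_0_compat; first exact: exp_pos.
apply: cos_gt_0; lra.
Qed.

(** * Comparison principle for strict subsolutions *)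

Section Comparison.

Variables (N : nat) (p dp ddp : 'I_N -> R -> R) (m kappa T w : R).
Hypothesis m_pos : 0 < m.
Hypothesis w_pos : 0 < w.
Hypothesis T_pos : 0 < T.
(** This bound makes a positive wave of frequency [w] a supersolution for [kappa]; the next one
    keeps the wave at rest nonnegative on [0, T]. *)
Hypothesis kappa_le : kappa <= m * w ^ 2 + / (4 * m).
Hypothesis T_le : w * T <= PI / 2 + rest_phase m w.
Hypothesis p_derive : forall i t, is_derive (p i) t (dp i t).
Hypothesis dp_derive : forall i t, is_derive (dp i) t (ddp i t).
Hypothesis dp0 : forall i, dp i 0 = 0.
Hypothesis pT : forall i, p i T = 0.
Hypothesis subsolution : forall i t, 0 <= t <= T ->
  (forall j, p j t <= p i t) -> 0 < p i t ->
  0 < m * ddp i t + dp i t + kappa * p i t.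

Let y := phase_wave m w (rest_phase m w).

Let y0_pos : 0 < y 0.
Proof.
have Hb := rest_phase_bound m w m_pos w_pos.
apply: phase_wave_pos; rewrite Rmult_0_r; lra.
Qed.

Let y_ge0 (t : R) : 0 <= t <= T -> 0 <= y t.
Proof.
move=> Ht; have Hb := rest_phase_bound m w m_pos w_pos.
have H1 : w * t <= w * T by apply: Rmult_le_compat_l; lra.
have H2 : 0 <= w * t by apply: Rmult_le_pos; lra.
apply: Rmult_le_pos; first exact: Rlt_le (exp_pos _).
apply: cos_ge_0; lra.
Qed.

(* [y] itself may vanish at [T]; a slightly larger phase makes it positive on
   the whole of [0, T] while keeping the strict inequality. *)
Lemma no_strict_crossing (P : R) (i : 'I_N) (d : R) :
  (forall j, p j 0 <= P) -> 0 <= d <= T -> 0 < p i d ->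
  P * y d < p i d * y 0 -> False.
Proof.
move=> HP Hd Hpd Hlt.
have Hb := rest_phase_bound m w m_pos w_pos.
set phi := rest_phase m w in Hb Hlt.
set h := fun e => p i d * phase_wave m w (phi + e) 0 - P * phase_wave m w (phi + e) d.
have Hh : continuity_pt h 0.
  apply: (is_derive_continuity_pt _ _ (Derive h 0)); apply: Derive_correct.
  rewrite /h /phase_wave; auto_derive; by [].
(* Positive [e] moves the zero of the wave beyond [T]; the upper bound keeps the wave positive at
   time 0. *)
have [e [He Hhe]] : exists e, 0 < e < PI / 2 - phi /\ 0 < h e.
  apply: pos_right_near => //; last lra.
  rewrite /h Rplus_0_r; rewrite -/y /y -/phi in Hlt *; lra.
have Hpos t : 0 <= t <= T -> 0 < phase_wave m w (phi + e) t.
  move=> Ht; have H1 : w * t <= w * T by apply: Rmult_le_compat_l; lra.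
  have H2 : 0 <= w * t by apply: Rmult_le_pos; lra.
  have := T_le; rewrite -/phi => ?; apply: phase_wave_pos; lra.
apply: (barrier N p dp ddp (phase_wave m w (phi + e)) (phase_wave' m w (phi + e))
  (phase_wave'' m w (phi + e)) m kappa T m_pos _ p_derive dp_derive
  _ _ Hpos _ subsolution _ i d Hd Hpd); first lra.
- by move=> t; apply: phase_wave_derive.
- by move=> t; apply: phase_wave'_derive.
- move=> t Ht; rewrite phase_wave_ode //.
  have := Hpos t Ht; move: (phase_wave _ _ _ _) => z Hz; nra.
- by move=> j; rewrite pT; apply: Rle_refl.
- move=> j; have := Hpos d Hd; have := HP j; rewrite /h in Hhe; nra.
Qed.

(** If no component starts positive, any positive value is a strict crossing with [P = 0]. Otherwise
    the largest initial component [p k] and the multiple of [y] with the same initial value both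
    start at rest, and [p k] has the larger second derivative; it rises above that multiple just
    after 0, which is a strict crossing. *)
Lemma comparison (i : 'I_N) (t : R) : 0 <= t <= T -> p i t <= 0.
Proof.
move=> Ht; case: (Rle_lt_dec (p i t) 0) => // Hpos; exfalso.
have HN : (0 < N)%N by case: (N) i {Hpos} => [[]|].
have [k Hk] := ex_argmax N (fun j => p j 0) HN.
case: (Rle_lt_dec (p k 0) 0) => Hk0.
  apply: (no_strict_crossing 0 i t) => //.
    by move=> j; apply: Rle_trans (Hk j) Hk0.
  rewrite Rmult_0_l; exact: Rmult_lt_0_compat.
have HyD s : is_derive (fun s => p k s * y 0 - p k 0 * y s) s
    (dp k s * y 0 - p k 0 * phase_wave' m w (rest_phase m w) s).
  apply: (is_derive_minus (V := R_NormedModule)).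
    by apply: (is_derive_scal_l (V := R_NormedModule)).
  by apply: is_derive_scal; apply: phase_wave_derive.
have HdyD s : is_derive
    (fun s => dp k s * y 0 - p k 0 * phase_wave' m w (rest_phase m w) s) s
    (ddp k s * y 0 - p k 0 * phase_wave'' m w (rest_phase m w) s).
  apply: (is_derive_minus (V := R_NormedModule)).
    by apply: (is_derive_scal_l (V := R_NormedModule)).
  by apply: is_derive_scal; apply: phase_wave'_derive.
have Hrest := phase_wave'_rest m w m_pos w_pos.
have [d [Hd1 Hd2]] : exists d, 0 < d < T /\
    p k 0 * y 0 - p k 0 * y 0 < p k d * y 0 - p k 0 * y d.
  apply: (increase_after _ _ _ _ _ T_pos HyD _ (HdyD 0)).
    by rewrite dp0 Hrest; ring.
  have H1 := subsolution k 0 ltac:(lra) Hk Hk0.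
  have H2 := phase_wave_ode m w (rest_phase m w) 0 m_pos.
  rewrite dp0 in H1; rewrite Hrest -/y in H2.
  have H3 : 0 < (m * ddp k 0 + 0 + kappa * p k 0) * y 0 by apply: Rmult_lt_0_compat.
  have H4 : 0 <= (m * w ^ 2 + / (4 * m) - kappa) * (p k 0 * y 0).
    apply: Rmult_le_pos; first lra.
    by apply: Rlt_le; apply: Rmult_lt_0_compat.
  have : 0 < m * (ddp k 0 * y 0 - p k 0 * phase_wave'' m w (rest_phase m w) 0) by nra.
  nra.
apply: (no_strict_crossing (p k 0) k d) => //; try lra.
(* Since [y d] is nonnegative, the strict inequality at [d] also gives [0 < p k d]. *)
have := y_ge0 d ltac:(lra); nra.
Qed.

End Comparison.

(** Here [w] is the frequency of the underdamped oscillator of stiffness [kappa], and the critical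
    time is the first zero of its wave at rest. Arcsine and arctangent agree because an angle with
    sine [1 / sqrt (4 m kappa)] has tangent [1 / sqrt (4 m kappa - 1) = 1 / (2 m w)]. *)
Lemma critical_time_frequency (m kappa : R) : 0 < m -> 1 / 4 < m * kappa ->
  let w := sqrt (4 * m * kappa - 1) / (2 * m) in
  [/\ 0 < w, m * w ^ 2 + / (4 * m) = kappa &
      critical_time m kappa = (PI / 2 + rest_phase m w) / w].
Proof.
move=> Hm Hk w.
have Hs : 0 < sqrt (4 * m * kappa - 1) by apply: sqrt_lt_R0; lra.
have Hs2 : sqrt (4 * m * kappa - 1) ^ 2 = 4 * m * kappa - 1 by rewrite pow2_sqrt //; lra.
have Hq : 0 < sqrt (4 * m * kappa) by apply: sqrt_lt_R0; lra.
have Hq2 : sqrt (4 * m * kappa) ^ 2 = 4 * m * kappa by rewrite pow2_sqrt //; lra.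
split.
- by apply: Rdiv_lt_0_compat; lra.
- have -> : m * w ^ 2 = sqrt (4 * m * kappa - 1) ^ 2 / (4 * m) by rewrite /w; field; lra.
  rewrite Hs2; field; lra.
- have -> : rest_phase m w = asin (1 / sqrt (4 * m * kappa)).
    rewrite asin_atan; last first.
      have Hq1 : 1 < sqrt (4 * m * kappa).
        by rewrite -sqrt_1; apply: sqrt_lt_1; lra.
      split; first by have := Rdiv_lt_0_compat 1 _ Rlt_0_1 Hq; lra.
      by apply: (Rmult_lt_reg_r _ _ _ Hq); rewrite /Rdiv Rmult_1_l Rinv_l; lra.
    rewrite /rest_phase; congr atan.
    have -> : 1 - (1 / sqrt (4 * m * kappa))² = (4 * m * kappa - 1) / (4 * m * kappa).
      have -> : (1 / sqrt (4 * m * kappa))² = / (sqrt (4 * m * kappa) ^ 2).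
        by rewrite /Rsqr; field; lra.
      rewrite Hq2; field; nra.
    rewrite sqrt_div; try lra.
    by rewrite /w; field; lra.
  by rewrite /critical_time /w; field; lra.
Qed.

Lemma ex_frequency (m kappa T : R) : 0 < m -> 0 < T ->
  (m * kappa <= 1 / 4 \/ (m * kappa > 1 / 4 /\ T <= critical_time m kappa)) ->
  exists w, [/\ 0 < w, kappa <= m * w ^ 2 + / (4 * m) &
             w * T <= PI / 2 + rest_phase m w].
Proof.
move=> Hm HT [H|[H1 H2]].
  (* Now [kappa <= 1 / (4 m)], so every frequency is stiff enough; this one reaches only the angle
     [PI / 2] at [T]. *)
  exists (PI / 2 / T).
  have Hpi := PI2_RGT_0.
  have Hw : 0 < PI / 2 / T by apply: Rdiv_lt_0_compat; lra.
  split=> //.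
    have : kappa <= / (4 * m).
      apply: (Rmult_le_reg_l m) => //; have -> : m * / (4 * m) = 1 / 4 by field; lra.
      lra.
    have : 0 <= m * (PI / 2 / T) ^ 2 by apply: Rmult_le_pos; [lra|exact: pow2_ge_0].
    lra.
  have -> : PI / 2 / T * T = PI / 2 by field; lra.
  have := rest_phase_bound m _ Hm Hw; lra.
have [Hw E1 E2] := critical_time_frequency m kappa Hm ltac:(lra).
move: (sqrt _ / _) Hw E1 E2 => w Hw E1 E2.
exists w; split=> //; first lra.
rewrite E2 in H2.
have -> : PI / 2 + rest_phase m w = w * ((PI / 2 + rest_phase m w) / w) by field; lra.
by apply: Rmult_le_compat_l; lra.
Qed.

(** * Uniqueness of the terminal velocity *)

Lemma is_derive_sum (N : nat) (f df : 'I_N -> R -> R) (t : R) :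
  (forall i, is_derive (f i) t (df i t)) ->
  is_derive (fun s => \big[Rplus/0]_(i < N) f i s) t
            (\big[Rplus/0]_(i < N) df i t).
Proof.
elim: N f df => [|N IH] f df H.
  rewrite big_ord0; apply: (is_derive_ext (fun=> 0)).
    by move=> s; rewrite big_ord0.
  exact: (is_derive_const (V := R_NormedModule)).
rewrite big_ord_recr /=.
apply: (is_derive_ext (fun s => \big[Rplus/0]_(i < N) f (widen_ord (leqnSn N) i) s
    + f ord_max s)).
  by move=> s; rewrite big_ord_recr.
apply: (is_derive_plus (V := R_NormedModule)) => //.
by apply: (IH (fun i => f (widen_ord _ i)) (fun i => df (widen_ord _ i))) => i.
Qed.

Lemma terminal_velocity_unique (N : nat) (m kappa w T : R)
    (nu X0 dX0 Y0 dY0 : vec N) (X dX Y dY : R -> vec N) :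
  0 < m -> 0 < kappa -> 0 < T -> 0 < w ->
  kappa <= m * w ^ 2 + / (4 * m) -> w * T <= PI / 2 + rest_phase m w ->
  kuramoto_solution m kappa nu X0 dX0 X dX ->
  kuramoto_solution m kappa nu Y0 dY0 Y dY ->
  dX0 = dY0 -> X T = Y T -> dX T = dY T.
Proof.
move=> Hm Hk HT Hw Hkw HwT [_ [EdX [VX [ddX [VdX HX]]]]]
  [_ [EdY [VY [ddY [VdY HY]]]]] E0 ET.
have Hext i := extend_C2 (fun s => X s i - Y s i) (fun s => dX s i - dY s i)
  (fun s => ddX s i - ddY s i)
  (fun t Ht => Dminus _ _ _ _ _ _ (VX i t Ht) (VY i t Ht))
  (fun t Ht => Dminus _ _ _ _ _ _ (VdX i t Ht) (VdY i t Ht)).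
have [p /fin_all_exists [dp /fin_all_exists [ddp H]]] := fin_all_exists Hext.
have Dp i t : is_derive (p i) t (dp i t) by case: (H i).
have Ddp i t : is_derive (dp i) t (ddp i t) by case: (H i) => _ [].
have Ep i t : 0 <= t -> p i t = X t i - Y t i.
  by case: (H i) => _ [_ E] Ht; case: (E t Ht).
have Edp i t : 0 <= t -> dp i t = dX t i - dY t i.
  by case: (H i) => _ [_ E] Ht; case: (E t Ht) => _ [].
have Eddp i t : 0 <= t -> ddp i t = ddX t i - ddY t i.
  by case: (H i) => _ [_ E] Ht; case: (E t Ht) => _ [].
apply/ffunP => i0.
have HN : (0 < N)%N by case: (N) i0 => [[]|].
have HNR : 0 < INR N by apply: lt_0_INR; apply/ssrnat.ltP.
have ode i t : 0 <= t -> m * ddp i t + dp i t = kappa / INR N *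
    (\big[Rplus/0]_(j < N) sin (X t j - X t i) -
     \big[Rplus/0]_(j < N) sin (Y t j - Y t i)).
  move=> Ht; rewrite Eddp // Edp //.
  have -> : m * (ddX t i - ddY t i) + (dX t i - dY t i) =
    (m * ddX t i + dX t i) - (m * ddY t i + dY t i) by ring.
  by rewrite HX // HY //; ring.
have dp0 i : dp i 0 = 0.
  by rewrite Edp; [rewrite EdX EdY E0; ring | exact: Rle_refl].
have pT i : p i T = 0 by rewrite Ep ?ET; [ring | lra].
(* The coupling cancels in the sum, so [m S'' + S' = 0]. With [S' 0 = 0] the integrating factor
   [exp (t / m)] gives [S' = 0], and [S] keeps its value 0 from time [T]. *)
pose S t := \big[Rplus/0]_(i < N) p i t.
pose S' t := \big[Rplus/0]_(i < N) dp i t.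
pose S'' t := \big[Rplus/0]_(i < N) ddp i t.
have DS t : is_derive S t (S' t) by apply: is_derive_sum.
have DS' t : is_derive S' t (S'' t) by apply: is_derive_sum.
have odeS t : 0 <= t -> m * S'' t + S' t = 0.
  move=> Ht; rewrite /S'' /S' big_distrr -big_split /=.
  have -> : \big[Rplus/0]_(i < N) (m * ddp i t + dp i t) =
    kappa / INR N * \big[Rplus/0]_(i < N)
    (\big[Rplus/0]_(j < N) sin (X t j - X t i) -
     \big[Rplus/0]_(j < N) sin (Y t j - Y t i)).
    by rewrite big_distrr; apply: eq_bigr => i _; exact: ode.
  rewrite sum_sub.
  by rewrite !sum_coupling; ring.
have S'0 t : 0 <= t <= T -> S' t = 0.
  move=> Ht.
  have HE s : is_derive (fun s => exp (s / m) * S' s) s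
      (exp (s / m) / m * S' s + exp (s / m) * S'' s).
    apply: (is_derive_mult (K := R_AbsRing)); [|exact: DS'|exact: Rmult_comm].
    by auto_derive => //; rewrite /Rdiv; ring.
  have := derive_zero_const _ _ T HE _ t Ht.
  have -> : S' 0 = 0 by rewrite /S' big1.
  move=> HH; have : exp (t / m) * S' t = 0.
    rewrite HH ?Rmult_0_r // => s Hs.
    have -> : exp (s / m) / m * S' s + exp (s / m) * S'' s =
      exp (s / m) / m * (m * S'' s + S' s) by field; lra.
    by rewrite odeS; [ring | lra].
  have := exp_pos (t / m) => He; case/Rmult_integral => //; lra.
have S0 t : 0 <= t <= T -> S t = 0.
  move=> Ht; rewrite (derive_zero_const S S' T DS S'0 t Ht).
  rewrite -(derive_zero_const S S' T DS S'0 T ltac:(lra)).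
  by rewrite /S big1.
have sub i t : 0 <= t <= T -> (forall j, p j t <= p i t) -> 0 < p i t ->
    0 < m * ddp i t + dp i t + kappa * p i t.
  move=> Ht Hmax Hpos; have Ht0 : 0 <= t by lra.
  rewrite ode // Ep //.
  have Hlt : - (INR N * (X t i - Y t i)) <
    \big[Rplus/0]_(j < N) sin (X t j - X t i) -
    \big[Rplus/0]_(j < N) sin (Y t j - Y t i).
    apply: coupling_gt.
    - by move=> j; rewrite -!Ep.
    - by apply: (etrans _ (S0 t Ht)); apply: eq_bigr => j _; rewrite Ep.
    - by rewrite -Ep.
  have Hq : 0 < kappa / INR N by apply: Rdiv_lt_0_compat.
  move: Hlt => /(Rmult_lt_compat_l _ _ _ Hq).
  have -> : kappa / INR N * - (INR N * (X t i - Y t i)) =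
    - (kappa * (X t i - Y t i)) by field; lra.
  lra.
have Hle := comparison N p dp ddp m kappa T w Hm Hw HT Hkw HwT Dp Ddp dp0 pT sub.
(* Nonpositive components with zero sum all vanish. *)
have Hzero i t : 0 <= t <= T -> p i t = 0.
  move=> Ht; case: (Rle_lt_or_eq_dec _ _ (Hle i t Ht)) => // Hlt.
  have := sum_lt N (fun j => p j t) (fun=> 0) i (fun j => Hle j t Ht) Hlt.
  rewrite -/(S t) S0 // sum_const; lra.
(* As [p] is known to vanish only up to [T], the derivative is read off a left difference
   quotient. *)
have Hdp : dp i0 T = 0.
  case: (Req_dec (dp i0 T) 0) => // Hne; exfalso.
  have [d Hd] := proj1 (is_derive_Reals (p i0) T (dp i0 T)) (Dp i0 T) (Rabs (dp i0 T)) (Rabs_pos_lt _ Hne).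
  have Hdp := cond_pos d.
  set h := Rmin (d / 2) T.
  have Hh1 : h <= d / 2 by exact: Rmin_l.
  have Hh2 : h <= T by exact: Rmin_r.
  have Hh : 0 < h by apply: Rmin_glb_lt; lra.
  have := Hd (- h) ltac:(lra) ltac:(rewrite Rabs_Ropp Rabs_pos_eq; lra).
  rewrite !Hzero; try lra.
  have -> : (0 - 0) / - h - dp i0 T = - dp i0 T by field; lra.
  rewrite Rabs_Ropp; lra.
by apply: Rminus_diag_uniq; rewrite -Edp ?Hdp; lra.
Qed.

(** * The damped pendulum *)

Lemma Rabs_sub_le (x y : R) : Rabs (x - y) <= Rabs x + Rabs y.
Proof. rewrite -(Rabs_Ropp y); exact: Rabs_triang. Qed.

Lemma sin_lipschitz (a b : R) : Rabs (sin a - sin b) <= Rabs (a - b).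
Proof.
have key x y : x < y -> Rabs (sin x - sin y) <= Rabs (x - y).
  move=> Hxy; have H1 := sin_sub_gt x y Hxy.
  (* A shift by [PI] changes the sign of sine and so turns the lower bound into the upper one. *)
  have H2 := sin_sub_gt (x + PI) (y + PI) ltac:(lra).
  rewrite !neg_sin in H2.
  rewrite (Rabs_left (x - y)); last lra.
  apply: Rabs_le; lra.
case: (Rtotal_order a b) => [|[->|]]; first exact: key.
  by rewrite !Rminus_diag Rabs_R0; apply: Rle_refl.
move=> H; rewrite Rabs_minus_sym (Rabs_minus_sym a); exact: key.
Qed.

(** Carries estimates on the Picard iterates over to their limit. *)
Lemma le_of_le_add_geometric (z Y K : R) :
  (forall n, z <= Y + K * (1 / 2) ^ n) -> z <= Y.
Proof.
move=> H; apply: Rnot_lt_le => Hlt.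
have HK : 0 < Rabs K + 1 by have := Rabs_pos K; lra.
have [n Hn] := pow_lt_1_zero (1 / 2) ltac:(rewrite Rabs_pos_eq; lra)
  ((z - Y) / (Rabs K + 1)) ltac:(apply: Rdiv_lt_0_compat; lra).
have := Hn n (le_n n); have Hp : 0 < (1 / 2) ^ n by apply: pow_lt; lra.
rewrite Rabs_pos_eq; last lra.
move=> H1; have H2 : (1 / 2) ^ n * (Rabs K + 1) < z - Y.
  have -> : z - Y = (z - Y) / (Rabs K + 1) * (Rabs K + 1) by field; lra.
  exact: Rmult_lt_compat_r.
have := H n; have := Rle_abs K; nra.
Qed.

Lemma is_derive_RInt_continuous (h : R -> R) (t : R) :
  (forall s, continuous h s) -> is_derive (fun t => RInt h 0 t) t (h t).
Proof.
move=> Hh; apply: (is_derive_RInt (V := R_NormedModule) h _ 0) => //.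
apply: filter_forall => s; apply: RInt_correct.
by apply: (ex_RInt_continuous (V := R_CompleteNormedModule)) => *.
Qed.

Lemma is_derive_continuous (f : R -> R) (t l : R) : is_derive f t l -> continuous f t.
Proof.
by move=> H; apply: (ex_derive_continuous (K := R_AbsRing) (V := R_NormedModule)); exists l.
Qed.

Lemma is_RInt_antiderivative (F f : R -> R) (a b : R) :
  (forall x, is_derive F x (f x)) -> (forall x, continuous f x) ->
  is_RInt f a b (F b - F a).
Proof.
move=> HF Hf; have -> : F b - F a = minus (F b) (F a) by [].
by apply: (is_RInt_derive (V := R_CompleteNormedModule)) => *; [exact: HF | exact: Hf].
Qed.

(** Each integration gains a factor [1 / L] in the exponentially weighted norm, which is why a large
    rate makes the Picard map contract. Negative times are handled by integrating over [t, 0]. *)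
Lemma RInt_exp_bound (h : R -> R) (B L t : R) :
  0 < L -> 0 <= B -> (forall s, continuous h s) ->
  (forall s, Rabs (h s) <= B * exp (L * Rabs s)) ->
  Rabs (RInt h 0 t) <= B / L * exp (L * Rabs t).
Proof.
move=> HL HB Hc Hh.
have Hint a b : is_RInt h a b (RInt h a b).
  apply: (RInt_correct (V := R_CompleteNormedModule)).
  by apply: (ex_RInt_continuous (V := R_CompleteNormedModule)) => *.
have HBL : 0 <= B / L by apply: Rdiv_le_0_compat.
case: (Rle_dec 0 t) => Ht.
  have Hg : is_RInt (fun s => B * exp (L * s)) 0 t
      (B / L * exp (L * t) - B / L * exp (L * 0)).
    apply: (is_RInt_antiderivative (fun s => B / L * exp (L * s))) => x.
      by auto_derive => //; field; lra.
    apply: (is_derive_continuous _ _ (B * (L * exp (L * x)))).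
    auto_derive => //; ring.
  have := norm_RInt_le (V := R_NormedModule) h _ 0 t _ _ Ht _ (Hint 0 t) Hg.
  rewrite Rmult_0_r exp_0 (Rabs_pos_eq t) //.
  move=> H; have {}H : Rabs (RInt h 0 t) <= B / L * exp (L * t) - B / L * 1.
    by apply: H => x Hx; rewrite -{2}(Rabs_pos_eq x); [exact: Hh | lra].
  lra.
have Ht' : t <= 0 by lra.
have Hg : is_RInt (fun s => B * exp (- (L * s))) t 0
    (- (B / L) * exp (- (L * 0)) - - (B / L) * exp (- (L * t))).
  apply: (is_RInt_antiderivative (fun s => - (B / L) * exp (- (L * s)))) => x.
    by auto_derive => //; field; lra.
  apply: (is_derive_continuous _ _ (B * (- L * exp (- (L * x))))).
  auto_derive => //; ring.
have := norm_RInt_le (V := R_NormedModule) h _ t 0 _ _ Ht' _ (Hint t 0) Hg.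
have <- : opp (RInt h t 0) = RInt h 0 t.
  by apply: (opp_RInt_swap (V := R_CompleteNormedModule)); exists (RInt h t 0).
rewrite Rmult_0_r Ropp_0 exp_0 (Rabs_left1 t) // /opp /= Rabs_Ropp.
have -> : L * - t = - (L * t) by ring.
move=> H; have {}H : Rabs (RInt h t 0) <= - (B / L) * 1 - - (B / L) * exp (- (L * t)).
  apply: H => x Hx; have -> : - (L * x) = L * Rabs x by rewrite Rabs_left1; lra.
  exact: Hh.
lra.
Qed.

(** * The pendulum flow by Picard iteration *)

Section Pendulum.

Variables m kappa : R.
Hypothesis m_pos : 0 < m.
Hypothesis kappa_pos : 0 < kappa.

(* Integrating [m x'' + x' + kappa sin x = 0] once with [x 0 = a], [x' 0 = 0]. *)
Let velocity (a : R) (f : R -> R) (s : R) : R :=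
  (a - f s) / m - kappa / m * RInt (fun r => sin (f r)) 0 s.

(** The Picard map: its continuous fixed points are the motions released at rest from [a]. *)
Let step (a : R) (f : R -> R) (t : R) : R := a + RInt (velocity a f) 0 t.

(* Large enough for [step] to halve the norm [sup |f t| exp (- rate |t|)]. *)
Let rate : R := 4 * (1 + kappa) / m + 1.

Let weight (t : R) : R := exp (rate * Rabs t).

Let rate_ge1 : 1 < rate.
Proof. by rewrite /rate; have := Rdiv_lt_0_compat (4 * (1 + kappa)) m; lra. Qed.

Let m_rate : m * rate = 4 + 4 * kappa + m.
Proof. by rewrite /rate; field; lra. Qed.

Let weight_ge1 (t : R) : 1 <= weight t.
Proof.
rewrite /weight; have := exp_ineq1_le (rate * Rabs t).
have : 0 <= rate * Rabs t by apply: Rmult_le_pos; [lra | exact: Rabs_pos].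
lra.
Qed.

Let sin_continuous (f : R -> R) :
  (forall s, continuous f s) -> forall s, continuous (fun r => sin (f r)) s.
Proof.
move=> Hf s; apply: continuous_comp => //.
exact: continuous_sin.
Qed.

Let velocity_continuous (a : R) (f : R -> R) :
  (forall s, continuous f s) -> forall s, continuous (velocity a f) s.
Proof.
move=> Hf s; apply: (continuous_minus (V := R_NormedModule)).
  apply: (continuous_mult (K := R_AbsRing)); last exact: continuous_const.
  apply: (continuous_minus (V := R_NormedModule)) => //; exact: continuous_const.
apply: (continuous_mult (K := R_AbsRing)); first exact: continuous_const.
apply: is_derive_continuous; apply: is_derive_RInt_continuous.
exact: sin_continuous.
Qed.

Let step_derive (a : R) (f : R -> R) :
  (forall s, continuous f s) -> forall t, is_derive (step a f) t (velocity a f t).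
Proof.
move=> Hf t; rewrite -[velocity a f t]Rplus_0_l.
apply: (is_derive_plus (V := R_NormedModule)); first exact: is_derive_const.
apply: is_derive_RInt_continuous; exact: velocity_continuous.
Qed.

(** Allowing two release angles lets one estimate serve both for convergence ([a = b]) and for
    Lipschitz dependence on the angle. *)
Let step_contract (a b B : R) (f g : R -> R) :
  0 <= B -> (forall s, continuous f s) -> (forall s, continuous g s) ->
  (forall s, Rabs (f s - g s) <= B * weight s) ->
  forall t, Rabs (step a f t - step b g t) <=
            (5 / 4 * Rabs (a - b) + B / 2) * weight t.
Proof.
move=> HB Hf Hg Hfg t.
have Hex (h : R -> R) u : (forall s, continuous h s) -> ex_RInt h 0 u.
  by move=> Hh; apply: (ex_RInt_continuous (V := R_CompleteNormedModule)) => *.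
have HD := Rabs_pos (a - b).
have Hin s : Rabs (RInt (fun r => sin (f r)) 0 s - RInt (fun r => sin (g r)) 0 s)
    <= B / rate * weight s.
  have <- : RInt (fun r => sin (f r) - sin (g r)) 0 s =
    RInt (fun r => sin (f r)) 0 s - RInt (fun r => sin (g r)) 0 s.
    apply: (RInt_minus (V := R_CompleteNormedModule)); apply: Hex; exact: sin_continuous.
  apply: RInt_exp_bound => //; first lra.
    move=> r; apply: (continuous_minus (V := R_NormedModule)); exact: sin_continuous.
  by move=> r; apply: Rle_trans (sin_lipschitz _ _) (Hfg r).
pose C := (Rabs (a - b) + B + kappa * (B / rate)) / m.
have HBr : 0 <= B / rate by apply: Rdiv_le_0_compat; lra.
have HC : 0 <= C by apply: Rdiv_le_0_compat => //; nra.
have HI : Rabs (RInt (velocity a f) 0 t - RInt (velocity b g) 0 t)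
    <= C / rate * weight t.
  have <- : RInt (fun r => velocity a f r - velocity b g r) 0 t =
    RInt (velocity a f) 0 t - RInt (velocity b g) 0 t.
    apply: (RInt_minus (V := R_CompleteNormedModule)); apply: Hex; exact: velocity_continuous.
  apply: RInt_exp_bound => //; first lra.
    move=> r; apply: (continuous_minus (V := R_NormedModule)); exact: velocity_continuous.
  move=> s; rewrite -/(weight s) /velocity.
  have -> : (a - f s) / m - kappa / m * RInt (fun r => sin (f r)) 0 s -
     ((b - g s) / m - kappa / m * RInt (fun r => sin (g r)) 0 s) =
     ((a - b) - (f s - g s) -
      kappa * (RInt (fun r => sin (f r)) 0 s - RInt (fun r => sin (g r)) 0 s)) / m.
    field; lra.
  rewrite /Rdiv Rabs_mult (Rabs_pos_eq (/ m)); last by apply: Rlt_le; apply: Rinv_0_lt_compat.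
  have -> : C * weight s = (Rabs (a - b) * weight s + B * weight s +
     kappa * (B / rate * weight s)) * / m by rewrite /C; field; lra.
  apply: Rmult_le_compat_r; first by apply: Rlt_le; apply: Rinv_0_lt_compat.
  have Hw := weight_ge1 s.
  have H1 := Hfg s; have H2 := Hin s.
  move: (RInt _ _ _ - _) H2 => I H2.
  have H3 : Rabs (kappa * I) <= kappa * (B / rate * weight s).
    rewrite Rabs_mult (Rabs_pos_eq kappa); last lra.
    by apply: Rmult_le_compat_l; lra.
  have H4 : Rabs (a - b) <= Rabs (a - b) * weight s by nra.
  have H5 := Rabs_sub_le (a - b - (f s - g s)) (kappa * I).
  have H6 := Rabs_sub_le (a - b) (f s - g s).
  lra.
(* By [m_rate] the denominator [m * rate] exceeds [4 + 4 kappa], while the numerator is at most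
   [|a - b| + (1 + kappa) B]. *)
have Hq : C / rate <= Rabs (a - b) / 4 + B / 2.
  have -> : C / rate = (Rabs (a - b) + B + kappa * (B / rate)) / (m * rate).
    by rewrite /C; field; lra.
  have Hmr : 0 < m * rate by nra.
  apply: (Rmult_le_reg_r _ _ _ Hmr).
  have -> : (Rabs (a - b) + B + kappa * (B / rate)) / (m * rate) * (m * rate) =
    Rabs (a - b) + B + kappa * (B / rate) by field; lra.
  rewrite m_rate.
  have : B / rate <= B.
    apply: (Rmult_le_reg_r rate); first lra.
    have -> : B / rate * rate = B by field; lra.
    nra.
  nra.
have Hw := weight_ge1 t.
rewrite /step.
have -> : a + RInt (velocity a f) 0 t - (b + RInt (velocity b g) 0 t) =
  (a - b) + (RInt (velocity a f) 0 t - RInt (velocity b g) 0 t) by ring.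
apply: Rle_trans (Rabs_triang _ _) _.
have : C / rate * weight t <= (Rabs (a - b) / 4 + B / 2) * weight t.
  by apply: Rmult_le_compat_r; lra.
nra.
Qed.

Let iterate (a : R) (n : nat) : R -> R := Nat.iter n (step a) (fun=> a).

Let iterate_continuous (a : R) (n : nat) : forall s, continuous (iterate a n) s.
Proof.
elim: n => [|n IH] s; first exact: continuous_const.
exact: is_derive_continuous (step_derive a _ IH s).
Qed.

Let iterate_succ (a : R) (n : nat) (t : R) :
  Rabs (iterate a n.+1 t - iterate a n t) <= kappa / m * (1 / 2) ^ n * weight t.
Proof.
elim: n t => [|n IH] t.
  have Hk : 0 <= kappa / m by apply: Rdiv_le_0_compat; lra.
  rewrite /iterate /= /step.
  have -> : a + RInt (velocity a (fun=> a)) 0 t - a = RInt (velocity a (fun=> a)) 0 t by ring.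
  have Hr : kappa / m / rate <= kappa / m.
    apply: (Rmult_le_reg_r rate); first lra.
    have -> : kappa / m / rate * rate = kappa / m by field; lra.
    nra.
  apply: (Rle_trans _ (kappa / m / rate * weight t)); last first.
    by apply: Rmult_le_compat_r; have := weight_ge1 t; lra.
  apply: RInt_exp_bound => //; first lra.
    apply: velocity_continuous => s; exact: continuous_const.
  move=> s; rewrite /velocity.
  have -> : (a - a) / m - kappa / m * RInt (fun=> sin a) 0 s =
            - (kappa / m * RInt (fun=> sin a) 0 s) by field; lra.
  rewrite Rabs_Ropp Rabs_mult (Rabs_pos_eq (kappa / m)) //.
  apply: Rmult_le_compat_l => //.
  have : Rabs (RInt (fun=> sin a) 0 s) <= 1 / rate * weight s.
    apply: RInt_exp_bound; try lra; first by move=> r; exact: continuous_const.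
    move=> r; have := weight_ge1 r; rewrite /weight.
    have : Rabs (sin a) <= 1 by apply: Rabs_le; exact: SIN_bound.
    lra.
  have : 1 / rate <= 1.
    apply: (Rmult_le_reg_r rate); first lra.
    have -> : 1 / rate * rate = 1 by field; lra.
    lra.
  have := weight_ge1 s; rewrite -/(weight s); nra.
have := step_contract a a (kappa / m * (1 / 2) ^ n) _ _ _
  (iterate_continuous a n.+1) (iterate_continuous a n) IH t.
rewrite Rminus_diag Rabs_R0 /= => H.
have {}H := H ltac:(apply: Rmult_le_pos; [apply: Rdiv_le_0_compat; lra | apply: pow_le; lra]).
apply: Rle_trans H _; apply: Req_le; field; lra.
Qed.

(** The sum of the geometric series of bounds in [iterate_succ]. *)
Let tail : R := 2 * (kappa / m).

Let iterate_tail (a : R) (n k : nat) (t : R) :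
  Rabs (iterate a (n + k) t - iterate a n t) <= tail * (1 / 2) ^ n * weight t.
Proof.
have Hk : 0 <= kappa / m by apply: Rdiv_le_0_compat; lra.
have Hw := weight_ge1 t.
(* The partial geometric sum is kept exact so that the induction on [k] closes. *)
have H : Rabs (iterate a (n + k) t - iterate a n t) <=
    tail * (1 / 2) ^ n * (1 - (1 / 2) ^ k) * weight t.
  elim: k => [|k IH].
    by rewrite addn0 Rminus_diag Rabs_R0 /=; apply: Req_le; ring.
  rewrite addnS.
  have -> : iterate a (n + k).+1 t - iterate a n t =
    (iterate a (n + k).+1 t - iterate a (n + k) t) +
    (iterate a (n + k) t - iterate a n t) by ring.
  apply: Rle_trans (Rabs_triang _ _) _.
  apply: Rle_trans (Rplus_le_compat _ _ _ _ (iterate_succ _ _ _) IH) _.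
  rewrite -[(n + k)%N]/(Nat.add n k) pow_add /tail /=; apply: Req_le; field; lra.
apply: Rle_trans H _.
apply: Rmult_le_compat_r; first lra.
have : 0 <= tail * (1 / 2) ^ n.
  by apply: Rmult_le_pos; [rewrite /tail; lra | apply: pow_le; lra].
have : 0 <= (1 / 2) ^ k by apply: pow_le; lra.
nra.
Qed.

(** A sigma type, so that the limit can be projected out as a function of [a] and [t]. *)
Let iterate_limit (a t : R) : {l : R | forall n,
  Rabs (l - iterate a n t) <= tail * weight t * (1 / 2) ^ n}.
Proof.
have Hk : 0 <= kappa / m by apply: Rdiv_le_0_compat; lra.
have HK : 0 <= tail * weight t.
  by apply: Rmult_le_pos; [rewrite /tail; lra | have := weight_ge1 t; lra].
have Hc : Cauchy_crit (fun n => iterate a n t).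
  move=> eps Heps.
  have [n0 Hn0] := pow_lt_1_zero (1 / 2) ltac:(rewrite Rabs_pos_eq; lra)
    (eps / 2 / (tail * weight t + 1)) ltac:(apply: Rdiv_lt_0_compat; lra).
  have Hsmall n : (n >= n0)%coq_nat -> Rabs (iterate a n t - iterate a n0 t) < eps / 2.
    move=> Hn; have -> : n = (n0 + (n - n0))%N by rewrite subnKC //; apply/ssrnat.leP.
    apply: Rle_lt_trans (iterate_tail _ _ _ _) _.
    have := Hn0 n0 (le_n _); rewrite Rabs_pos_eq; last by apply: pow_le; lra.
    have Hp : 0 <= (1 / 2) ^ n0 by apply: pow_le; lra.
    move=> H; have : (1 / 2) ^ n0 * (tail * weight t + 1) < eps / 2.
      have -> : eps / 2 = eps / 2 / (tail * weight t + 1) * (tail * weight t + 1) by field; lra.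
      by apply: Rmult_lt_compat_r; lra.
    nra.
  exists n0 => p q Hp Hq; rewrite /R_dist.
  have -> : iterate a p t - iterate a q t =
    (iterate a p t - iterate a n0 t) + - (iterate a q t - iterate a n0 t) by ring.
  apply: Rle_lt_trans (Rabs_triang _ _) _; rewrite Rabs_Ropp.
  have := Hsmall p Hp; have := Hsmall q Hq; lra.
have [l Hl] := Rcomplete.R_complete _ Hc.
exists l => n; apply: le_epsilon => eps Heps.
have [n1 Hn1] := Hl eps Heps.
have := Hn1 (n + n1)%N ltac:(by apply/ssrnat.leP; exact: leq_addl).
rewrite /R_dist Rabs_minus_sym.
have -> : l - iterate a n t =
  (l - iterate a (n + n1) t) + (iterate a (n + n1) t - iterate a n t) by ring.
have := Rabs_triang (l - iterate a (n + n1) t) (iterate a (n + n1) t - iterate a n t).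
have := iterate_tail a n n1 t; lra.
Qed.

Let solution (a t : R) : R := proj1_sig (iterate_limit a t).

Let solution_close (a t : R) (n : nat) :
  Rabs (solution a t - iterate a n t) <= tail * weight t * (1 / 2) ^ n.
Proof. by rewrite /solution; case: (iterate_limit a t). Qed.

Let solution_continuous (a : R) : forall t, continuous (solution a) t.
Proof.
move=> t; apply/continuity_pt_filterlim => eps Heps.
have Hk : 0 <= kappa / m by apply: Rdiv_le_0_compat; lra.
(* Bounds [tail * weight] on the unit neighbourhood of [t], where convergence is therefore uniform;
   a three-epsilon argument follows. *)
pose W := tail * exp (rate * (Rabs t + 1)).
have HW : 0 <= W.
  by apply: Rmult_le_pos; [rewrite /tail; lra | exact: Rlt_le (exp_pos _)].
have [n0 Hn0] := pow_lt_1_zero (1 / 2) ltac:(rewrite Rabs_pos_eq; lra)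
  (eps / 3 / (W + 1)) ltac:(apply: Rdiv_lt_0_compat; lra).
have Hp : 0 <= (1 / 2) ^ n0 by apply: pow_le; lra.
have Hn : W * (1 / 2) ^ n0 < eps / 3.
  have := Hn0 n0 (le_n _); rewrite Rabs_pos_eq //.
  move=> H; have : (1 / 2) ^ n0 * (W + 1) < eps / 3.
    have -> : eps / 3 = eps / 3 / (W + 1) * (W + 1) by field; lra.
    by apply: Rmult_lt_compat_r; lra.
  nra.
have Hclose s : Rabs s <= Rabs t + 1 -> Rabs (solution a s - iterate a n0 s) < eps / 3.
  move=> Hs; apply: Rle_lt_trans (solution_close a s n0) _; apply: Rle_lt_trans _ Hn.
  apply: Rmult_le_compat_r => //; apply: Rmult_le_compat_l; first by rewrite /tail; lra.
  have : rate * Rabs s <= rate * (Rabs t + 1) by apply: Rmult_le_compat_l; lra.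
  case/Rle_lt_or_eq_dec => [/exp_increasing|E]; first exact: Rlt_le.
  by rewrite /weight E; apply: Rle_refl.
have /continuity_pt_filterlim Hc := iterate_continuous a n0 t.
have [d [Hd H]] := Hc (eps / 3) ltac:(lra).
exists (Rmin d 1); split; first by apply: Rmin_glb_lt; lra.
move=> s [Hs1 Hs2]; have H1 := H s.
rewrite /= /R_dist in Hs2 H1 *.
have Hd1 := Rmin_l d 1; have Hd2 := Rmin_r d 1.
have {}H1 := H1 (conj Hs1 (Rlt_le_trans _ _ _ Hs2 Hd1)).
have Hst : Rabs s <= Rabs t + 1.
  have := Rabs_triang t (s - t); have -> : t + (s - t) = s by ring.
  lra.
have H2 := Hclose s Hst; have H3 := Hclose t ltac:(lra).
have -> : solution a s - solution a t = (solution a s - iterate a n0 s) +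
  ((iterate a n0 s - iterate a n0 t) + - (solution a t - iterate a n0 t)) by ring.
have := Rabs_triang (solution a s - iterate a n0 s)
  ((iterate a n0 s - iterate a n0 t) + - (solution a t - iterate a n0 t)).
have := Rabs_triang (iterate a n0 s - iterate a n0 t) (- (solution a t - iterate a n0 t)).
rewrite Rabs_Ropp; lra.
Qed.

(** Both sides lie within a geometrically small distance of the iterate of index [n + 1]. *)
Let solution_fixed (a t : R) : solution a t = step a (solution a) t.
Proof.
have Hk : 0 <= kappa / m by apply: Rdiv_le_0_compat; lra.
have H : Rabs (solution a t - step a (solution a) t) <= 0.
  apply: (le_of_le_add_geometric _ _ (tail * weight t)) => n.
  have H1 := solution_close a t n.+1.
  have H2 := step_contract a a (tail * (1 / 2) ^ n) _ _ _ (iterate_continuous a n)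
    (solution_continuous a) _ t.
  have {}H2 := H2 ltac:(apply: Rmult_le_pos; [rewrite /tail; lra | apply: pow_le; lra]).
  rewrite Rminus_diag Rabs_R0 in H2.
  have {}H2 : Rabs (iterate a n.+1 t - step a (solution a) t) <=
      (5 / 4 * 0 + tail * (1 / 2) ^ n / 2) * weight t.
    apply: H2 => s; rewrite Rabs_minus_sym.
    by have := solution_close a s n; lra.
  have := Rabs_triang (solution a t - iterate a n.+1 t)
    (iterate a n.+1 t - step a (solution a) t).
  have -> : solution a t - iterate a n.+1 t + (iterate a n.+1 t - step a (solution a) t)
    = solution a t - step a (solution a) t by ring.
  rewrite -tech_pow_Rmult in H1; lra.
have := Rabs_pos (solution a t - step a (solution a) t) => H0.
have : Rabs (solution a t - step a (solution a) t) = 0 by lra.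
case: (Req_dec (solution a t - step a (solution a) t) 0) => [|/Rabs_no_R0 //]; lra.
Qed.

Let solution_lipschitz (a b t : R) :
  Rabs (solution a t - solution b t) <= 3 * Rabs (a - b) * weight t.
Proof.
have HD := Rabs_pos (a - b).
(* The constant 3 is preserved by [step_contract], since [5 / 4 + 3 / 2 <= 3]. *)
have H n : forall s, Rabs (iterate a n s - iterate b n s) <= 3 * Rabs (a - b) * weight s.
  elim: n => [|n IH] s.
    by rewrite /iterate /=; have := weight_ge1 s; nra.
  have := step_contract a b _ _ _ _ (iterate_continuous a n) (iterate_continuous b n) IH s.
  move=> H; apply: Rle_trans (H ltac:(lra)) _.
  by have := weight_ge1 s; nra.
apply: (le_of_le_add_geometric _ _ (2 * (tail * weight t))) => n.
have := H n t; have H1 := solution_close a t n; have H2 := solution_close b t n.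
have -> : solution a t - solution b t = (solution a t - iterate a n t) +
  ((iterate a n t - iterate b n t) + - (solution b t - iterate b n t)) by ring.
have := Rabs_triang (solution a t - iterate a n t)
  ((iterate a n t - iterate b n t) + - (solution b t - iterate b n t)).
have := Rabs_triang (iterate a n t - iterate b n t) (- (solution b t - iterate b n t)).
rewrite Rabs_Ropp; lra.
Qed.

(** Every iterate is the constant [a], hence so is the limit. It serves for the angles 0 and
    [PI]. *)
Let solution_equilibrium (a t : R) : sin a = 0 -> solution a t = a.
Proof.
move=> Ha.
have H n : forall s, iterate a n s = a.
  elim: n => [//|n IH] s; rewrite /iterate /= -/(iterate a n) /step.
  rewrite (RInt_ext _ (fun=> 0)).
    by rewrite RInt_const /scal /= /mult /=; ring.
  move=> r _; rewrite /velocity IH (RInt_ext _ (fun=> 0)).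
    by rewrite RInt_const /scal /= /mult /=; field; lra.
  by move=> q _; rewrite IH.
have H0 : Rabs (solution a t - a) <= 0.
  apply: (le_of_le_add_geometric _ _ (tail * weight t)) => n.
  have := solution_close a t n; rewrite H; lra.
case: (Req_dec (solution a t - a) 0) => [|/Rabs_pos_lt]; lra.
Qed.

Lemma pendulum_flow : exists (x v : R -> R -> R) (L : R), 0 < L /\
  [/\ forall a, x a 0 = a /\ v a 0 = 0,
      forall a t, is_derive (x a) t (v a t),
      forall a t, is_derive (v a) t (- (v a t + kappa * sin (x a t)) / m),
      forall a b t, Rabs (x a t - x b t) <= 3 * Rabs (a - b) * exp (L * Rabs t) &
      forall a t, sin a = 0 -> x a t = a].
Proof.
exists solution, (fun a => velocity a (solution a)), rate; split; first lra.
have Hx a t : is_derive (solution a) t (velocity a (solution a) t).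
  apply: (is_derive_ext (step a (solution a))).
    by move=> s; rewrite -solution_fixed.
  apply: step_derive; exact: solution_continuous.
have H0 a : solution a 0 = a.
  by rewrite solution_fixed /step RInt_point /zero /=; ring.
split=> //.
- move=> a; split=> //.
  by rewrite /velocity RInt_point H0 /zero /=; field; lra.
- move=> a t; rewrite /velocity.
  have HI : is_derive (fun s => RInt (fun r => sin (solution a r)) 0 s) t (sin (solution a t)).
    apply: (is_derive_RInt_continuous (fun r => sin (solution a r))).
    apply: sin_continuous; exact: solution_continuous.
  have -> : - (velocity a (solution a) t + kappa * sin (solution a t)) / m =
    (0 - velocity a (solution a) t) * / m - kappa / m * sin (solution a t).
    by field; lra.
  apply: (is_derive_minus (V := R_NormedModule)).
    apply: (is_derive_scal_l (V := R_NormedModule) (fun s => a - solution a s)).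
    apply: (is_derive_minus (V := R_NormedModule)); [exact: is_derive_const | exact: Hx].
  exact: is_derive_scal.
Qed.

End Pendulum.

(** * Return of the pendulum at a prescribed time *)

Lemma nondecreasing_of_derive (f df : R -> R) (a b : R) : a <= b ->
  (forall x, is_derive f x (df x)) -> (forall x, a <= x <= b -> 0 <= df x) ->
  f a <= f b.
Proof.
move=> Hab Hf H0; case: (Rle_lt_or_eq_dec _ _ Hab) => [Hlt|->]; last exact: Rle_refl.
have [c [Hc1 Hc2]] := MVT_cor2 f df a b Hlt
  (fun c _ => proj1 (is_derive_Reals f c (df c)) (Hf c)).
have := H0 c ltac:(lra); nra.
Qed.

(* [(x^2 + v^2) exp (C t)] is nondecreasing for this [C]. *)
Lemma pendulum_backward_uniqueness (m kappa t : R) (x v : R -> R) :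
  0 < m -> 0 < kappa -> 0 <= t ->
  (forall s, is_derive x s (v s)) ->
  (forall s, is_derive v s (- (v s + kappa * sin (x s)) / m)) ->
  x t = 0 -> v t = 0 -> x 0 = 0.
Proof.
move=> Hm Hk Ht Hx Hv Hxt Hvt.
pose C := 1 + (2 + kappa) / m.
pose E s := (x s ^ 2 + v s ^ 2) * exp (C * s).
(* This grouping shows the sign: [v^2 - 2 v sin x + sin^2 x] is a square and [sin^2 x <= x^2]. *)
pose E' s := ((x s + v s) ^ 2 + (2 * x s ^ 2
  + kappa * (x s ^ 2 + v s ^ 2 - 2 * v s * sin (x s))) / m) * exp (C * s).
have HE s : is_derive E s (E' s).
  have H1 : is_derive (fun s => x s ^ 2) s (INR 2 * v s * x s ^ 1).
    exact: is_derive_pow.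
  have H2 : is_derive (fun s => v s ^ 2) s
      (INR 2 * (- (v s + kappa * sin (x s)) / m) * v s ^ 1).
    exact: is_derive_pow.
  have H3 : is_derive (fun s => exp (C * s)) s (C * exp (C * s)).
    by auto_derive => //; ring.
  have -> : E' s = (INR 2 * v s * x s ^ 1 +
    INR 2 * (- (v s + kappa * sin (x s)) / m) * v s ^ 1) * exp (C * s)
    + (x s ^ 2 + v s ^ 2) * (C * exp (C * s)).
    by rewrite /E' /C /=; field; lra.
  apply: (is_derive_mult (K := R_AbsRing)) => //; last exact: Rmult_comm.
  exact: (is_derive_plus (V := R_NormedModule)).
have HE0 s : 0 <= s <= t -> 0 <= E' s.
  move=> _; apply: Rmult_le_pos; last exact: Rlt_le (exp_pos _).
  have H1 : sin (x s) ^ 2 <= x s ^ 2.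
    have := sin_lipschitz (x s) 0; rewrite sin_0 !Rminus_0_r => /Rsqr_le_abs_1.
    by rewrite /Rsqr /=; lra.
  have H2 : 0 <= (x s + v s) ^ 2 by exact: pow2_ge_0.
  have H3 : 0 <= (v s - sin (x s)) ^ 2 by exact: pow2_ge_0.
  have H4 : 0 <= x s ^ 2 by exact: pow2_ge_0.
  have H5 : 0 <= x s ^ 2 + v s ^ 2 - 2 * v s * sin (x s) by nra.
  have : 0 <= (2 * x s ^ 2
    + kappa * (x s ^ 2 + v s ^ 2 - 2 * v s * sin (x s))) / m.
    apply: Rdiv_le_0_compat => //.
    have : 0 <= kappa * (x s ^ 2 + v s ^ 2 - 2 * v s * sin (x s)).
      by apply: Rmult_le_pos => //; lra.
    lra.
  lra.
have := nondecreasing_of_derive E E' 0 t Ht HE HE0.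
rewrite /E Hxt Hvt Rmult_0_r exp_0 => H.
have H1 := pow2_ge_0 (v 0); have H2 := pow2_ge_0 (x 0).
have : x 0 ^ 2 = 0 by lra.
by rewrite /= Rmult_1_r => /Rmult_integral [].
Qed.

(** The witness is the supremum of the parameters whose trajectory is nonpositive somewhere on
    [0, T]. By the Lipschitz bound, a negative value there would persist, as a nonpositive one, at a
    larger parameter, and a positive minimum would exclude all parameters slightly below. *)
Lemma ex_first_touching (x : R -> R -> R) (T K lo hi : R) :
  0 <= T -> 0 < K -> lo <= hi ->
  (forall a t, continuity_pt (x a) t) ->
  (forall a b t, 0 <= t <= T -> Rabs (x a t - x b t) <= K * Rabs (a - b)) ->
  (exists t, 0 <= t <= T /\ x lo t <= 0) ->
  (forall t, 0 <= t <= T -> 0 < x hi t) ->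
  exists a, [/\ lo <= a <= hi, forall t, 0 <= t <= T -> 0 <= x a t &
             exists t, 0 <= t <= T /\ x a t = 0].
Proof.
move=> HT HK Hlohi Hc HL Hlo Hhi.
pose S a := lo <= a <= hi /\ exists t, 0 <= t <= T /\ x a t <= 0.
have Sb : bound S by exists hi => a [[]].
have Se : exists a, S a by exists lo; split => //; lra.
have [a [Hub Hlub]] := completeness S Sb Se.
have Ha : lo <= a <= hi.
  split; first by apply: Hub; split => //; lra.
  by apply: Hlub => b [[]].
have Hpos t : 0 <= t <= T -> 0 <= x a t.
  move=> Ht; apply: Rnot_lt_le => Hneg.
  have Hah : a < hi.
    case: (Rle_lt_or_eq_dec _ _ (proj2 Ha)) => // E.
    have := Hhi t Ht; rewrite -E; lra.
  (* The increment is at most [- x a t / K], so [x b t] cannot exceed 0. *)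
  pose b := a + Rmin (hi - a) (- x a t / K).
  have Hq : 0 < - x a t / K by apply: Rdiv_lt_0_compat; lra.
  have Hb0 : 0 < Rmin (hi - a) (- x a t / K) by apply: Rmin_glb_lt; lra.
  have Hb1 := Rmin_l (hi - a) (- x a t / K).
  have Hb2 := Rmin_r (hi - a) (- x a t / K).
  have : S b.
    split; first by rewrite /b; lra.
    exists t; split => //.
    have := HL b a t Ht; have -> : b - a = Rmin (hi - a) (- x a t / K) by rewrite /b; ring.
    rewrite (Rabs_pos_eq (Rmin _ _)); last lra.
    have := Rle_abs (x b t - x a t).
    have : K * Rmin (hi - a) (- x a t / K) <= K * (- x a t / K).
      by apply: Rmult_le_compat_l; lra.
    have -> : K * (- x a t / K) = - x a t by field; lra.
    lra.
  move=> /Hub; rewrite /b; lra.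
exists a; split => //.
have [tm [Hmin Htm]] := continuity_ab_min (x a) 0 T HT (fun t _ => Hc a t).
exists tm; split => //.
apply: Rle_antisym; last exact: Hpos.
apply: Rnot_lt_le => Hm.
have Hq : 0 < x a tm / K by apply: Rdiv_lt_0_compat.
have : a <= a - x a tm / K.
  apply: Hlub => b [Hb [t [Ht Hbt]]].
  have Hba : b <= a by apply: Hub; split => //; exists t.
  have H1 := HL a b t Ht.
  rewrite (Rabs_pos_eq (a - b)) in H1; last lra.
  have H2 := Rle_abs (x a t - x b t); have H3 := Hmin t Ht.
  have : x a tm / K * K = x a tm by field; lra.
  nra.
lra.
Qed.

Lemma sin_ge_linear (c : R) : c < 1 ->
  exists d, 0 < d /\ forall x, 0 < x < d -> c * x <= sin x.
Proof.
move=> Hc; have [d Hd] := derivable_pt_lim_sin 0 (1 - c) ltac:(lra).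
exists d; split; first exact: cond_pos.
move=> x Hx; have := Hd x ltac:(lra) ltac:(rewrite Rabs_pos_eq; lra).
rewrite Rplus_0_l sin_0 cos_0 Rminus_0_r => /Rabs_def2 [_ H].
have -> : sin x = sin x / x * x by field; lra.
apply: Rmult_le_compat_r; lra.
Qed.

(* By continuity, a linear oscillator slightly slower than the critical one
   still vanishes before [T]. *)
Lemma ex_slower_frequency (m kappa T : R) :
  0 < m -> m * kappa > 1 / 4 -> T > critical_time m kappa ->
  exists w, [/\ 0 < w, m * w ^ 2 + / (4 * m) < kappa &
             PI / 2 + rest_phase m w <= w * T].
Proof.
move=> Hm Hk HT.
have [Hw E1 E2] := critical_time_frequency m kappa Hm ltac:(lra).
move: (sqrt _ / _) Hw E1 E2 => w Hw E1 E2.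
pose h e := (w - e) * T - PI / 2 - rest_phase m (w - e).
have Hh : continuity_pt h 0.
  apply: (is_derive_continuity_pt _ _ (Derive h 0)); apply: Derive_correct.
  rewrite /h /rest_phase; auto_derive; nra.
have Hh0 : 0 < h 0.
  rewrite /h Rminus_0_r; rewrite E2 in HT.
  have : (PI / 2 + rest_phase m w) / w * w < T * w by apply: Rmult_lt_compat_r.
  have -> : (PI / 2 + rest_phase m w) / w * w = PI / 2 + rest_phase m w by field; lra.
  lra.
have [e [He Hhe]] := pos_right_near h w Hh Hh0 Hw.
exists (w - e); split; [lra | | by rewrite /h in Hhe; lra].
rewrite -E1; apply: Rplus_lt_compat_r; apply: Rmult_lt_compat_l => //; nra.
Qed.

(* The Wronskian of [x] with the slower oscillator would be nonincreasing from
   0, yet positive at the first zero of the oscillator. *)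
Lemma small_pendulum_returns (m kappa w T d : R) (x v : R -> R) :
  0 < m -> 0 < kappa -> 0 < w ->
  PI / 2 + rest_phase m w <= w * T ->
  (forall z, 0 < z < d -> (m * w ^ 2 + / (4 * m)) * z <= kappa * sin z) ->
  (forall t, is_derive x t (v t)) ->
  (forall t, is_derive v t (- (v t + kappa * sin (x t)) / m)) ->
  v 0 = 0 -> (forall t, 0 <= t <= T -> x t < d) ->
  exists t, 0 <= t <= T /\ x t <= 0.
Proof.
move=> Hm Hk Hw HwT Hsin Hx Hv Hv0 Hd.
apply: Classical_Prop.NNPP => Hno.
have Hpos t : 0 <= t <= T -> 0 < x t.
  by move=> Ht; apply: Rnot_le_lt => Hle; apply: Hno; exists t.
have Hb := rest_phase_bound m w Hm Hw.
have Hrest := phase_wave'_rest m w Hm Hw.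
set phi := rest_phase m w in Hb HwT Hrest.
pose T' := (PI / 2 + phi) / w.
have ET' : w * T' = PI / 2 + phi by rewrite /T'; field; lra.
have HT' : 0 < T' by apply: Rdiv_lt_0_compat; lra.
have HTT : T' <= T by apply: (Rmult_le_reg_l w) => //; lra.
pose y := phase_wave m w phi; pose y' := phase_wave' m w phi.
(* The exponential absorbs the damping; the sign turns the nonincreasing Wronskian into a
   nondecreasing function. *)
pose W t := - (exp (t / m) * (v t * y t - x t * y' t)).
pose W' t := exp (t / m) / m * (y t * (kappa * sin (x t) - (m * w ^ 2 + / (4 * m)) * x t)).
have HW t : is_derive W t (W' t).
  have H1 : is_derive (fun s => exp (s / m)) t (exp (t / m) / m).
    by auto_derive => //; rewrite /Rdiv; ring.
  have H2 := is_derive_mult (K := R_AbsRing) v y t _ _ (Hv t)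
    (phase_wave_derive m w phi t Hm) Rmult_comm.
  have H3 := is_derive_mult (K := R_AbsRing) x y' t _ _ (Hx t)
    (phase_wave'_derive m w phi t Hm) Rmult_comm.
  have H4 := is_derive_minus (V := R_NormedModule) _ _ _ _ _ H2 H3.
  have H5 := is_derive_mult (K := R_AbsRing) _ _ t _ _ H1 H4 Rmult_comm.
  have H6 := is_derive_opp (V := R_NormedModule) _ _ _ H5.
  have Hode := phase_wave_ode m w phi t Hm; rewrite -/(y t) -/(y' t) in Hode.
  have Eq : phase_wave'' m w phi t =
    (- (m * w ^ 2 + / (4 * m)) * y t - y' t) / m by rewrite -Hode; field; lra.
  have -> : W' t = opp (plus (mult (exp (t / m) / m)
    (minus (mult (v t) (y t)) (mult (x t) (y' t))))
    (mult (exp (t / m)) (minus (plus (mult (- (v t + kappa * sin (x t)) / m) (y t))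
       (mult (v t) (phase_wave' m w phi t)))
       (plus (mult (v t) (y' t)) (mult (x t) (phase_wave'' m w phi t)))))).
    rewrite Eq -/(y' t) /opp /minus /plus /mult /opp /= /W'; field; lra.
  exact: H6.
have HW0 t : 0 <= t <= T' -> 0 <= W' t.
  move=> Ht; apply: Rmult_le_pos.
    by apply: Rdiv_le_0_compat => //; exact: Rlt_le (exp_pos _).
  apply: Rmult_le_pos.
    have H1 : w * t <= w * T' by apply: Rmult_le_compat_l; lra.
    have H2 : 0 <= w * t by apply: Rmult_le_pos; lra.
    apply: Rmult_le_pos; first exact: Rlt_le (exp_pos _).
    by apply: cos_ge_0; lra.
  have := Hsin (x t) (conj (Hpos t ltac:(lra)) (Hd t ltac:(lra))); lra.
have := nondecreasing_of_derive W W' 0 T' (Rlt_le _ _ HT') HW HW0.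
have -> : W 0 = 0 by rewrite /W Hv0 /y' Hrest; ring.
have HyT : y T' = 0.
  rewrite /y /phase_wave ET'; have -> : PI / 2 + phi - phi = PI / 2 by ring.
  by rewrite cos_PI2; ring.
have Hy'T : y' T' = - (exp (- T' / (2 * m)) * w).
  rewrite /y' /phase_wave' ET'; have -> : PI / 2 + phi - phi = PI / 2 by ring.
  by rewrite cos_PI2 sin_PI2; field; lra.
rewrite /W HyT Hy'T => H.
have H1 := exp_pos (T' / m); have H2 := exp_pos (- T' / (2 * m)).
have H3 := Hpos T' ltac:(lra).
have H4 : 0 < exp (T' / m) * (x T' * (exp (- T' / (2 * m)) * w)).
  by do 3 (apply: Rmult_lt_0_compat => //).
lra.
Qed.

Lemma ex_pendulum_return (m kappa T : R) :
  0 < m -> 0 < kappa -> 0 < T -> m * kappa > 1 / 4 -> T > critical_time m kappa ->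
  exists x v : R -> R,
    [/\ forall t, is_derive x t (v t),
        forall t, is_derive v t (- (v t + kappa * sin (x t)) / m) &
        [/\ v 0 = 0, x T = 0 & v T <> 0]].
Proof.
move=> Hm Hk HT Hmk Hcrit.
have [x [v [L [HL [H0 Hx Hv Hlip Heq]]]]] := pendulum_flow m kappa Hm Hk.
have [w [Hw Hwk HwT]] := ex_slower_frequency m kappa T Hm Hmk Hcrit.
have [d [Hd Hsin]] := sin_ge_linear ((m * w ^ 2 + / (4 * m)) / kappa)
  ltac:(apply: (Rmult_lt_reg_r kappa) => //; rewrite /Rdiv Rmult_assoc Rinv_l; lra).
pose K := 3 * exp (L * T).
have HK : 0 < K by apply: Rmult_lt_0_compat; [lra | exact: exp_pos].
have HlipK a b t : 0 <= t <= T -> Rabs (x a t - x b t) <= K * Rabs (a - b).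
  move=> Ht; apply: Rle_trans (Hlip a b t) _.
  have -> : K * Rabs (a - b) = 3 * Rabs (a - b) * exp (L * T) by rewrite /K; ring.
  apply: Rmult_le_compat_l; first by have := Rabs_pos (a - b); lra.
  rewrite Rabs_pos_eq; last lra.
  have : L * t <= L * T by apply: Rmult_le_compat_l; lra.
  case/Rle_lt_or_eq_dec => [/exp_increasing|->]; [exact: Rlt_le | exact: Rle_refl].
(* The first bound keeps the trajectory from [a0] below [d / 2] on [0, T], where sine dominates the
   linear force; the second gives [a0 <= PI]. *)
pose a0 := Rmin (d / (2 * K)) 1.
have Ha1 : a0 <= d / (2 * K) by exact: Rmin_l.
have Ha2 : a0 <= 1 by exact: Rmin_r.
have Ha0 : 0 < a0 by apply: Rmin_glb_lt; [apply: Rdiv_lt_0_compat; lra | lra].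
have Hpi := PI2_1.
have [a [Ha Hge [t [Ht Hat]]]] : exists a, [/\ a0 <= a <= PI,
    forall t, 0 <= t <= T -> 0 <= x a t & exists t, 0 <= t <= T /\ x a t = 0].
  apply: (ex_first_touching x T K) => //; try lra.
  - move=> a t; exact: is_derive_continuity_pt (Hx a t).
  - apply: (small_pendulum_returns m kappa w T d (x a0) (v a0)) => //.
    + move=> z Hz; have := Hsin z Hz => H.
      have -> : (m * w ^ 2 + / (4 * m)) * z = kappa * ((m * w ^ 2 + / (4 * m)) / kappa * z).
        by field; lra.
      by apply: Rmult_le_compat_l; lra.
    + by case: (H0 a0).
    + move=> t Ht; have := HlipK a0 0 t Ht.
      rewrite (Heq 0 t sin_0) !Rminus_0_r (Rabs_pos_eq a0); last lra.
      have : K * a0 <= K * (d / (2 * K)) by apply: Rmult_le_compat_l; lra.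
      have -> : K * (d / (2 * K)) = d / 2 by field; lra.
      have := Rle_abs (x a0 t); lra.
  - move=> t Ht; rewrite (Heq PI t sin_PI); lra.
have Hv_ne s : 0 <= s -> x a s = 0 -> v a s <> 0.
  move=> Hs Hxs Hvs.
  have := pendulum_backward_uniqueness m kappa s (x a) (v a) Hm Hk Hs (Hx a) (Hv a) Hxs Hvs.
  case: (H0 a) => -> _; lra.
(* A zero strictly inside (0, T) would be a minimum of the nonnegative trajectory, hence have zero
   velocity, against [Hv_ne]. *)
have EtT : t = T.
  case: (Req_dec t T) => // Hne; exfalso.
  have Ht0 : t <> 0.
    by move=> E; rewrite E in Hat; case: (H0 a) => Ha' _; rewrite Ha' in Hat; lra.
  apply: (Hv_ne t) => //; first lra.
  have : - v a t = 0.
    apply: (interior_max_derive (fun s => - x a s) 0 T t); first lra.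
      exact: (is_derive_opp (V := R_NormedModule)).
    by move=> s Hs; rewrite Hat; have := Hge s Hs; lra.
  lra.
rewrite EtT in Hat.
exists (x a), (v a); split => //; split => //; first by case: (H0 a).
by apply: Hv_ne => //; lra.
Qed.

(** * Two-cluster solutions *)

(* One oscillator against the [n] others: [c i x] has mean zero, and every phase
   difference across the two clusters is [x]. *)
Definition cluster_coef (n : nat) (i : 'I_n.+1) : R :=
  if i == ord0 then INR n / INR n.+1 else - (1 / INR n.+1).

Definition cluster (n : nat) (x : R -> R) (t : R) : vec n.+1 :=
  [ffun i => cluster_coef n i * x t].

(** Only the opposite cluster contributes: [n] terms [sin (- z)] for the lone oscillator, a single
    [sin z] for each other one. *)
Lemma cluster_coupling (n : nat) (z : R) (i : 'I_n.+1) :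
  / INR n.+1 * \big[Rplus/0]_(j < n.+1) sin (cluster_coef n j * z - cluster_coef n i * z) =
  - (cluster_coef n i * sin z).
Proof.
have HN : 0 < INR n.+1 by apply: lt_0_INR; apply/ssrnat.ltP.
have HS := S_INR n.
rewrite big_ord_recl {1}/cluster_coef eqxx.
rewrite (eq_bigr (fun=> sin (- (1 / INR n.+1) * z - cluster_coef n i * z))); last first.
  by move=> j _; rewrite {1}/cluster_coef.
rewrite sum_const /cluster_coef; case: (i == ord0).
  have -> : INR n / INR n.+1 * z - INR n / INR n.+1 * z = 0 by ring.
  have -> : - (1 / INR n.+1) * z - INR n / INR n.+1 * z = - z by rewrite HS; field; lra.
  rewrite sin_0 sin_neg; field; lra.
have -> : - (1 / INR n.+1) * z - - (1 / INR n.+1) * z = 0 by ring.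
have -> : INR n / INR n.+1 * z - - (1 / INR n.+1) * z = z by rewrite HS; field; lra.
rewrite sin_0; field; lra.
Qed.

Lemma cluster_velocity (n : nat) (x v : R -> R) :
  (forall t, is_derive x t (v t)) -> is_velocity (cluster n x) (cluster n v).
Proof.
move=> Hx i t _.
apply: (D_in_imp _ _ no_cond) => //.
apply/derivable_pt_lim_D_in/is_derive_Reals; rewrite ffunE.
apply: (is_derive_ext (fun s => cluster_coef n i * x s)).
  by move=> s; rewrite ffunE.
exact: is_derive_scal.
Qed.

Lemma cluster_solution (n : nat) (m kappa : R) (x v : R -> R) :
  0 < m ->
  (forall t, is_derive x t (v t)) ->
  (forall t, is_derive v t (- (v t + kappa * sin (x t)) / m)) ->
  kuramoto_solution m kappa [ffun=> 0] (cluster n x 0) (cluster n v 0)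
    (cluster n x) (cluster n v).
Proof.
move=> Hm Hx Hv; split=> //; split=> //; split; first exact: cluster_velocity.
exists (cluster n (fun t => - (v t + kappa * sin (x t)) / m)).
split; first exact: cluster_velocity.
move=> i t _; rewrite !ffunE.
have -> : \big[Rplus/0]_(j < n.+1) sin (cluster n x t j - cluster_coef n i * x t) =
  \big[Rplus/0]_(j < n.+1) sin (cluster_coef n j * x t - cluster_coef n i * x t).
  by apply: eq_bigr => j _; rewrite ffunE.
by rewrite {2}/Rdiv Rmult_assoc cluster_coupling; field; lra.
Qed.

Theorem proposition5p2 (kappa m tstar : R)
    (hkappa : 0 < kappa) (hm : 0 < m) (ht : 0 < tstar) :
  ((m * kappa <= 1 / 4 \/
    (m * kappa > 1 / 4 /\ tstar <= critical_time m kappa)) ->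
   forall (N : nat) (hN : (1 <= N)%N)
     (nu Theta0 dTheta0 Phi0 dPhi0 : vec N)
     (Theta dTheta Phi dPhi : R -> vec N),
     kuramoto_solution m kappa nu Theta0 dTheta0 Theta dTheta ->
     kuramoto_solution m kappa nu Phi0 dPhi0 Phi dPhi ->
     dTheta0 = dPhi0 ->
     Theta tstar = Phi tstar ->
     dTheta tstar = dPhi tstar)
  /\
  (forall N : nat,
     m * kappa > 1 / 4 -> tstar > critical_time m kappa -> (2 <= N)%N ->
     exists (nu Theta0 dTheta0 Phi0 dPhi0 : vec N)
       (Theta dTheta Phi dPhi : R -> vec N),
       kuramoto_solution m kappa nu Theta0 dTheta0 Theta dTheta /\
       kuramoto_solution m kappa nu Phi0 dPhi0 Phi dPhi /\
       dTheta0 = dPhi0 /\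
       Theta tstar = Phi tstar /\
       dTheta tstar <> dPhi tstar).
Proof.
split.
  move=> Hcase N _ nu X0 dX0 Y0 dY0 X dX Y dY HX HY E0 ET.
  have [w [Hw Hkw HwT]] := ex_frequency m kappa tstar hm ht Hcase.
  exact: (terminal_velocity_unique N m kappa w tstar nu X0 dX0 Y0 dY0) HX HY E0 ET.
(* With [N = n + 2] the lone oscillator faces [n + 1 >= 1] others, so its coefficient is nonzero. *)
case=> [//|[//|n]] Hmk Hcrit _.
have [x [v [Hx Hv [Hv0 HxT HvT]]]] :=
  ex_pendulum_return m kappa tstar hm hkappa ht Hmk Hcrit.
(* The mirror motion solves the same equation as sine is odd. It shares the zero initial velocity
   and the zero position at [tstar]. *)
pose x' t := - x t; pose v' t := - v t.
have Hx' t : is_derive x' t (v' t) by apply: (is_derive_opp (V := R_NormedModule)).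
have Hv' t : is_derive v' t (- (v' t + kappa * sin (x' t)) / m).
  have -> : - (v' t + kappa * sin (x' t)) / m = - (- (v t + kappa * sin (x t)) / m).
    by rewrite /v' /x' sin_neg; field; lra.
  exact: (is_derive_opp (V := R_NormedModule)).
exists [ffun=> 0], (cluster n.+1 x 0), (cluster n.+1 v 0),
  (cluster n.+1 x' 0), (cluster n.+1 v' 0),
  (cluster n.+1 x), (cluster n.+1 v), (cluster n.+1 x'), (cluster n.+1 v').
split; first exact: cluster_solution.
split; first exact: cluster_solution.
split; first by apply/ffunP => i; rewrite !ffunE /v' Hv0; ring.
split; first by apply/ffunP => i; rewrite !ffunE /x' HxT; ring.
(* The lone oscillator has opposite velocities in the two solutions; equality would force
   [v tstar = 0]. *)
move=> /ffunP /(_ ord0); rewrite !ffunE /v' /cluster_coef eqxx => E.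
have Hc : 0 < INR n.+1 / INR n.+2.
  by apply: Rdiv_lt_0_compat; apply: lt_0_INR; apply/ssrnat.ltP.
have : INR n.+1 / INR n.+2 * v tstar = 0 by lra.
by case/Rmult_integral; lra.
Qed.
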